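(* Consider the semi-implicit two-derivative predictor-corrector method described in the context, applied to $y'=z$, $z'=\frac1\varepsilon g(y,z)$ with fixed step size $\Delta t$. Assume that the discrete solution at time level $t=0$ is well-prepared. Assume furthermore that the discrete solution possesses a Hilbert expansion in $\varepsilon$. Then for all times $t^n$, $$g\left(y^n_{(0)},z^n_{(0)}\right)=0$$ and $$\nabla g\left(y^n_{(0)},z^n_{(0)}\right)\cdot\begin{pmatrix} z^n_{(0)}\\ \nabla g\left(y^n_{(0)},z^n_{(0)}\right)\cdot\begin{pmatrix} y^n_{(1)}\\ z^n_{(1)}\end{pmatrix}\end{pmatrix}=0.$$ This implies that the method is asymptotic preserving.
   Context: Setting: $g:\mathbb{R}^2\to\mathbb{R}$ is smooth, $0<\varepsilon\ll1$, and $y'(t)=z(t)$, $z'(t)=\frac{1}{\varepsilon}g(y(t),z(t))$, $y(0)=y^0$, $z(0)=z^0$. Define $\nabla g=(\partial_y g,\partial_z g)$ and $\dot g(y,z):=\nabla g(y,z)\cdot\begin{pmatrix} z\\ \frac{1}{\varepsilon}g(y,z)\end{pmatrix}$. Standing assumptions: there is $c>0$ with $\partial_z g(y,z)<-c$ for all $y,z\in\mathbb{R}$; and there are constants $L_g,L_{\dot g}$ independent of $\varepsilon$ with $|g(y_1,z_1)-g(y_2,z_2)|\le L_g\|(y_1-y_2,z_1-z_2)\|$ and $|\dot g(y_1,z_1)-\dot g(y_2,z_2)|\le \frac{L_{\dot g}}{\varepsilon}\|(y_1-y_2,z_1-z_2)\|$. Discrete solution: the time levels are $0=t^0<t^1<\dots<t^N$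 with $t^{n+1}-t^n=\Delta t$, and the method produces discrete numerical approximations $y^n\approx y(t^n)$, $z^n\approx z(t^n)$. Method (one step from $(y^n,z^n)$ at $t^n$ to $(y^{n+1},z^{n+1})$ at $t^{n+1}=t^n+\Delta t$). Write $g^n=g(y^n,z^n)$, $\dot g^n=\dot g(y^n,z^n)$, $g^{[k]}=g(y^{[k]},z^{[k]})$, $\dot g^{[k]}=\dot g(y^{[k]},z^{[k]})$. Predict: $y^{[0]}=y^n+\Delta t\,z^n+\frac{\Delta t^2}{2\varepsilon}g^n$, and $z^{[0]}$ solves $z^{[0]}=z^n+\frac{\Delta t}{\varepsilon}g^{[0]}-\frac{\Delta t^2}{2\varepsilon}\dot g^{[0]}$. Correct: for $0\le k\le k_{\max}-1$, $$y^{[k+1]}=y^n+\tfrac{\Delta t}{2}(z^n+z^{[k]})+\tfrac{\Delta t^2}{12\varepsilon}(g^n-g^{[k]}),$$ and $z^{[k+1]}$ solves $$z^{[k+1]}=z^n+\tfrac{\Delta t}{\varepsilon}(g^{[k+1]}-g^{[k]})-\tfrac{\Delta t^2}{2\varepsilon}(\dot g^{[k+1]}-\dot g^{[k]})+\tfrac{\Delta t}{2\varepsilon}(g^n+g^{[k]})+\tfrac{\Delta t^2}{12\varepsilon}(\dot g^n-\dot g^{[k]}).$$ Update: $y^{n+1}=y^{[k_{\max}]}$, $z^{n+1}=z^{[k_{\max}]}$. Hilbert expansion: an $\varepsilon$-dependent quantity $u$ possesses a Hilbert expansion if there are unique $\varepsilon$-independent coefficients $u_{(0)},u_{(1)},u_{(2)},\dots$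 with $u=u_{(0)}+\varepsilon u_{(1)}+\varepsilon^2u_{(2)}+\cdots$ as $\varepsilon\to0$ (asymptotic expansion, $\Delta t$ held fixed); a subscript $(j)$ denotes the $j$-th coefficient. Well-prepared: a pair $(y^0,z^0)$ is well-prepared if $y^0,z^0$ possess Hilbert expansions and $$g(y^0_{(0)},z^0_{(0)})=0,\qquad \nabla g(y^0_{(0)},z^0_{(0)})\cdot\begin{pmatrix} z^0_{(0)}\\ \nabla g(y^0_{(0)},z^0_{(0)})\cdot\begin{pmatrix} y^0_{(1)}\\ z^0_{(1)}\end{pmatrix}\end{pmatrix}=0.$$ Asymptotic preserving: the discretization obtained by letting $\varepsilon\to0$ with $\Delta t$ held constant is a consistent discretization of the limit problem $y_{(0)}'=z_{(0)}$, $0=g(y_{(0)},z_{(0)})$. In terms of limits, writing $w_{\Delta t,(\varepsilon)}$ for the numerical solution and $w_{(0)}$ for the solution of the limit problem: $\lim_{\Delta t\to0}\lim_{\varepsilon\to0}w_{\Delta t,(\varepsilon)}=\lim_{\varepsilon\to0}\lim_{\Delta t\to0}w_{\Delta t,(\varepsilon)}=w_{(0)}$. *)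

(* Defs.v *)
(* Concrete real numbers of Stdlib, analysis from Coquelicot. *)
From Stdlib Require Export Reals.
From Coquelicot Require Export Coquelicot.
Open Scope R_scope.

Definition smooth (g : R -> R -> R) : Prop :=
  forall (n : nat) (y z : R), ex_diff_n g n y z.

Definition dy (g : R -> R -> R) (y z : R) : R := Derive (fun u => g u z) y.
Definition dz (g : R -> R -> R) (y z : R) : R := Derive (fun v => g y v) z.

(* The product [nabla g (y, z) . (a, b)]. *)
Definition grad_dot (g : R -> R -> R) (y z a b : R) : R :=
  dy g y z * a + dz g y z * b.

(* Time derivative of [g] along the flow of y' = z, z' = g (y, z) / e. *)
Definition gdot (g : R -> R -> R) (e y z : R) : R :=
  grad_dot g y z z (1 / e * g y z).

(** * The method *)

(* The implicit equations for the z-components are kept as equations: no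
   existence or uniqueness of their solutions is presupposed, and a step is a
   relation between old and new values. *)

Definition predictor (g : R -> R -> R) (e dt yn zn y z : R) : Prop :=
  y = yn + dt * zn + dt ^ 2 / (2 * e) * g yn zn /\
  z = zn + dt / e * g y z - dt ^ 2 / (2 * e) * gdot g e y z.

Definition corrector (g : R -> R -> R) (e dt yn zn yk zk y z : R) : Prop :=
  y = yn + dt / 2 * (zn + zk) + dt ^ 2 / (12 * e) * (g yn zn - g yk zk) /\
  z = zn + dt / e * (g y z - g yk zk)
      - dt ^ 2 / (2 * e) * (gdot g e y z - gdot g e yk zk)
      + dt / (2 * e) * (g yn zn + g yk zk)
      + dt ^ 2 / (12 * e) * (gdot g e yn zn - gdot g e yk zk).

Definition one_step (g : R -> R -> R) (kmax : nat) (e dt yn zn y z : R) : Prop :=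
  exists ys zs : nat -> R,
    predictor g e dt yn zn (ys 0%nat) (zs 0%nat) /\
    (forall k : nat, (k < kmax)%nat ->
       corrector g e dt yn zn (ys k) (zs k) (ys (S k)) (zs (S k))) /\
    y = ys kmax /\ z = zs kmax.

Definition numerical_solution (g : R -> R -> R) (kmax : nat) (e dt : R)
    (N : nat) (y z : nat -> R) : Prop :=
  forall n : nat, (n < N)%nat ->
    one_step g kmax e dt (y n) (z n) (y (S n)) (z (S n)).

(** * Hilbert expansions *)

(* [is_domin F f h] is "h = o(f) along F". *)
Definition hilbert_expansion (u : R -> R) (c : nat -> R) : Prop :=
  forall m : nat,
    is_domin (at_right 0) (fun e : R => e ^ m)
      (fun e : R => u e - sum_n (fun j => c j * e ^ j) m).

Definition has_hilbert_expansion (u : R -> R) : Prop :=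
  exists! c : nat -> R, hilbert_expansion u c.

Definition well_prepared (g : R -> R -> R) (y z : R -> R) : Prop :=
  has_hilbert_expansion y /\ has_hilbert_expansion z /\
  forall yc zc : nat -> R,
    hilbert_expansion y yc -> hilbert_expansion z zc ->
    let y0 := yc 0%nat in let y1 := yc 1%nat in
    let z0 := zc 0%nat in let z1 := zc 1%nat in
    g y0 z0 = 0 /\ grad_dot g y0 z0 z0 (grad_dot g y0 z0 y1 z1) = 0.

(** * Asymptotic preservation *)

(* Solutions on [0, T] of Y' = Z, 0 = g (Y, Z). *)
Definition limit_solution (g : R -> R -> R) (T : R) (Y Z : R -> R) : Prop :=
  continuous_on (fun s : R => 0 <= s <= T) Y /\
  (forall s : R, 0 < s < T -> is_derive Y s (Z s)) /\
  (forall s : R, 0 <= s <= T -> g (Y s) (Z s) = 0).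

(* One step of the discretization obtained as e -> 0 with [dt] held constant:
   it is started from well-prepared data with leading coefficients (y, z). *)
Definition limit_step (g : R -> R -> R) (kmax : nat) (dt y z y' z' : R) : Prop :=
  exists (ye ze ye' ze' : R -> R) (yc zc : nat -> R),
    well_prepared g ye ze /\
    hilbert_expansion ye yc /\ hilbert_expansion ze zc /\
    yc 0%nat = y /\ zc 0%nat = z /\
    at_right 0 (fun e => one_step g kmax e dt (ye e) (ze e) (ye' e) (ze' e)) /\
    filterlim ye' (at_right 0) (locally y') /\
    filterlim ze' (at_right 0) (locally z').

(* The local error of the limit discretization is o(dt), uniformly in time. *)
Definition limit_consistent (g : R -> R -> R) (kmax : nat) : Prop :=
  forall (T : R) (Y Z : R -> R), 0 < T -> limit_solution g T Y Z ->
  forall eta : R, 0 < eta ->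
  exists d : R, 0 < d /\
    forall s dt y' z' : R, 0 <= s -> 0 < dt < d -> s + dt <= T ->
      limit_step g kmax dt (Y s) (Z s) y' z' ->
      Rabs (y' - Y (s + dt)) <= eta * dt /\ Rabs (z' - Z (s + dt)) <= eta * dt.

(* lim_{a, F} lim_{b, G} w a b = l, including existence of the inner limits. *)
Definition iterated_lim {A B : Type} {U : UniformSpace}
    (F : (A -> Prop) -> Prop) (G : (B -> Prop) -> Prop)
    (w : A -> B -> U) (l : U) : Prop :=
  exists v : A -> U,
    F (fun a => filterlim (w a) G (locally (v a))) /\
    filterlim v F (locally l).

(* The step size is dt = T / N, so that dt -> 0 is N -> oo; [y N e n], [z N e n]
   is the numerical solution at time level n for this step size and parameter e.
   The solution at a time t in [0, T] is read off at time levels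
   t^(nu N) = nu N * T / N tending to t.  Solvability of the implicit equations
   is only asked for in the regimes seen by the two iterated limits: small e for
   each fixed step size, and small step sizes for each fixed small e. *)
Definition limits_commute (g : R -> R -> R) (kmax : nat) : Prop :=
  forall (T : R) (y0 z0 : R -> R) (yc zc : nat -> R)
         (y z : nat -> R -> nat -> R) (Y Z : R -> R),
    0 < T ->
    well_prepared g y0 z0 ->
    hilbert_expansion y0 yc -> hilbert_expansion z0 zc ->
    (forall (N : nat) (e : R), y N e 0%nat = y0 e /\ z N e 0%nat = z0 e) ->
    (forall N : nat, (0 < N)%nat ->
       at_right 0 (fun e =>
         numerical_solution g kmax e (T / INR N) N (y N e) (z N e))) ->
    at_right 0 (fun e =>
      eventually (fun N =>
        numerical_solution g kmax e (T / INR N) N (y N e) (z N e))) ->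
    (forall N n : nat, (0 < N)%nat -> (n <= N)%nat ->
       has_hilbert_expansion (fun e => y N e n) /\
       has_hilbert_expansion (fun e => z N e n)) ->
    limit_solution g T Y Z -> Y 0 = yc 0%nat -> Z 0 = zc 0%nat ->
    forall (t : R) (nu : nat -> nat),
      0 <= t <= T ->
      (forall N : nat, (nu N <= N)%nat) ->
      is_lim_seq (fun N => INR (nu N) * (T / INR N)) t ->
      iterated_lim eventually (at_right 0)
        (fun N e => (y N e (nu N), z N e (nu N))) (Y t, Z t) /\
      iterated_lim (at_right 0) eventually
        (fun e N => (y N e (nu N), z N e (nu N))) (Y t, Z t).

Definition asymptotic_preserving (g : R -> R -> R) (kmax : nat) : Prop :=
  limit_consistent g kmax /\ limits_commute g kmax.

(* Main.v *)
(* Write zeta for the function whose graph is the zero set of g, which exists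
   and is Lipschitz because dz g < -c.

   For e -> 0 with dt fixed, the implicit equation of a stage forces
   g (y, z) = O(e) and gdot -> 0: its leading term is
   dt^2 / (2 e) * dz g * g, and |dz g| > c.  Hence each stage converges to a
   point of the graph of zeta, with 1 / e * g converging to the derivative of
   zeta (Y) along Y' = zeta (Y); this passes from stage to stage and from step to
   step without any expansion in e.  If expansions do exist, the limit of
   1 / e * g is grad g . (y1, z1), and gdot -> 0 is the second condition of
   well-preparedness.  The limit scheme obtained in this way is an explicit
   one-step method with local error O(dt^2) for Y' = zeta (Y), which gives
   consistency and the limit dt -> 0 after e -> 0.

   For dt -> 0 with e fixed, the method is first-order accurate for the
   Lipschitz system y' = z, z' = g / e, which has a global solution by Picard
   iteration.  That solution tends to the limit solution as e -> 0 by a Lyapunov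
   estimate for the defect g (y, z), which is damped at rate c / e. *)

Require Import Defs.
From Stdlib Require Import Reals Lra Lia IndefiniteDescription.
From Coquelicot Require Import Coquelicot.
Open Scope R_scope.

(** * Limits along a filter *)

(** The stages inside a step carry no assumed expansion, so the induction cannot run on
    coefficients. It runs on [gdot -> 0] instead: since [gdot = dy g * z + dz g * (g / e)] and
    [dz g] stays away from 0, this determines the limit of [g / e], the only singular quantity in
    the explicit y-equations. The obstacle is a circle: bounding g in an implicit equation requires
    a bound on z, through the term [dy g * z], while z is only known through its distance to the
    graph of zeta, that is, through g. The circle closes because these terms carry a factor e and
    can be absorbed for small e.

    When dt -> 0 comes first, constants may depend on e in any way, so a crude Lipschitz estimate is
    enough. Uniformity in e matters for the exact solution, and there the Lyapunov function controls
    [g ^ 2] with the weight e / c only; a second differential inequality, for [g ^ 2] alone with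
    damping rate c / e, shows that g itself tends to 0. No initial layer appears, because
    well-prepared data have g -> 0 at time 0. *)

Lemma filter_imp2 {T : Type} (F : (T -> Prop) -> Prop) {FF : Filter F}
    (P Q S : T -> Prop) :
  (forall x, P x -> Q x -> S x) -> F P -> F Q -> F S.
Proof.
  intros H HP HQ. generalize (filter_and _ _ HP HQ).
  apply filter_imp. intros x [H1 H2]. exact (H x H1 H2).
Qed.

Section Limits.

Context {T : Type} (F : (T -> Prop) -> Prop) {FF : Filter F}.

Lemma lim_eps (f : T -> R) (l : R) :
  filterlim f F (locally l) <->
  (forall eps : R, 0 < eps -> F (fun x => Rabs (f x - l) < eps)).
Proof.
  rewrite filterlim_locally. split.
  - intros H eps He. exact (H (mkposreal eps He)).
  - intros H eps. exact (H eps (cond_pos eps)).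
Qed.

Lemma lim_plus (f h : T -> R) (a b : R) :
  filterlim f F (locally a) -> filterlim h F (locally b) ->
  filterlim (fun x => f x + h x) F (locally (a + b)).
Proof.
  intros Hf Hh. apply (filterlim_comp_2 f h Rplus Hf Hh).
  exact (filterlim_plus a b).
Qed.

Lemma lim_opp (f : T -> R) (a : R) :
  filterlim f F (locally a) -> filterlim (fun x => - f x) F (locally (- a)).
Proof.
  intros Hf. exact (filterlim_comp _ _ _ f Ropp _ _ _ Hf (filterlim_opp a)).
Qed.

Lemma lim_minus (f h : T -> R) (a b : R) :
  filterlim f F (locally a) -> filterlim h F (locally b) ->
  filterlim (fun x => f x - h x) F (locally (a - b)).
Proof. intros Hf Hh. exact (lim_plus _ _ _ _ Hf (lim_opp _ _ Hh)). Qed.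

Lemma lim_mult (f h : T -> R) (a b : R) :
  filterlim f F (locally a) -> filterlim h F (locally b) ->
  filterlim (fun x => f x * h x) F (locally (a * b)).
Proof.
  intros Hf Hh. apply (filterlim_comp_2 f h Rmult Hf Hh).
  exact (filterlim_mult a b).
Qed.

Lemma lim_inv (f : T -> R) (a : R) :
  a <> 0 -> filterlim f F (locally a) ->
  filterlim (fun x => / f x) F (locally (/ a)).
Proof.
  intros Ha Hf.
  refine (filterlim_comp _ _ _ f Rinv _ _ _ Hf _).
  apply (continuous_Rinv a Ha).
Qed.

Lemma lim_2d (h : R -> R -> R) (u v : T -> R) (a b : R) :
  continuity_2d_pt h a b ->
  filterlim u F (locally a) -> filterlim v F (locally b) ->
  filterlim (fun x => h (u x) (v x)) F (locally (h a b)).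
Proof.
  intros Hh Hu Hv. apply lim_eps. intros eps He.
  destruct (Hh (mkposreal eps He)) as [d Hd].
  generalize (proj1 (lim_eps _ _) Hu d (cond_pos d)).
  generalize (proj1 (lim_eps _ _) Hv d (cond_pos d)).
  apply filter_imp2; [exact FF|]. intros x Hx1 Hx2. exact (Hd _ _ Hx2 Hx1).
Qed.

Lemma lim_squeeze (f h : T -> R) (l : R) :
  F (fun x => Rabs (f x - l) <= h x) -> filterlim h F (locally 0) ->
  filterlim f F (locally l).
Proof.
  intros Hf Hh. apply lim_eps. intros eps He.
  generalize (proj1 (lim_eps _ _) Hh eps He). revert Hf.
  apply filter_imp2; [exact FF|]. intros x H1 H2.
  rewrite Rminus_0_r in H2. apply Rle_lt_trans with (h x); [exact H1|].
  apply Rle_lt_trans with (2 := H2). apply Rle_abs.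
Qed.

Lemma lim_bounded (f : T -> R) (l : R) :
  filterlim f F (locally l) -> F (fun x => Rabs (f x) <= Rabs l + 1).
Proof.
  intros Hf. generalize (proj1 (lim_eps _ _) Hf 1 Rlt_0_1).
  apply filter_imp. intros x Hx.
  replace (f x) with (l + (f x - l)) by ring.
  apply Rle_trans with (1 := Rabs_triang _ _). lra.
Qed.

Lemma lim_eq (f : T -> R) (l m : R) :
  l = m -> filterlim f F (locally l) -> filterlim f F (locally m).
Proof. intros <-. tauto. Qed.

Lemma lim_abs_0 (f : T -> R) :
  filterlim f F (locally 0) <-> filterlim (fun x => Rabs (f x)) F (locally 0).
Proof.
  rewrite !lim_eps.
  split; intros H eps He; generalize (H eps He); apply filter_imp; intros x;
    rewrite !Rminus_0_r, Rabs_Rabsolu; tauto.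
Qed.

End Limits.

Lemma lim_pair {T : Type} (F : (T -> Prop) -> Prop) {FF : Filter F}
    (u v : T -> R) (a b : R) :
  filterlim u F (locally a) -> filterlim v F (locally b) ->
  filterlim (fun x => (u x, v x)) F (locally (a, b)).
Proof.
  intros Hu Hv.
  apply (filterlim_comp_2 u v (fun x y => (x, y)) Hu Hv).
  intros P [d Hd].
  exists (ball a d) (ball b d); try apply locally_ball.
  intros x y Hx Hy. apply Hd. split; assumption.
Qed.

Ltac limits :=
  repeat match goal with
  | |- filterlim _ _ _ => assumption
  | |- filterlim (fun x => Rminus (@?f x) (@?h x)) _ _ => apply (lim_minus _ f h)
  | |- filterlim (fun x => Rplus (@?f x) (@?h x)) _ _ => apply (lim_plus _ f h)
  | |- filterlim (fun x => Rmult (@?f x) (@?h x)) _ _ => apply (lim_mult _ f h)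
  | |- filterlim (fun _ => ?c) _ _ => apply filterlim_const
  end.

Lemma at_right_id : filterlim (fun e : R => e) (at_right 0) (locally 0).
Proof. intros P HP. apply filter_le_within. exact HP. Qed.

Lemma at_right_pos : at_right 0 (fun e => 0 < e).
Proof. exists (mkposreal 1 Rlt_0_1). intros y _ H. exact H. Qed.

Lemma at_right_lt (d : R) : 0 < d -> at_right 0 (fun e => e < d).
Proof.
  intros Hd. exists (mkposreal d Hd). intros y H _.
  apply Rle_lt_trans with (1 := Rle_abs y).
  change (Rabs (y - 0) < d) in H. rewrite Rminus_0_r in H. exact H.
Qed.

(** * The zero set of g *)

Lemma smooth_dy_continuous (g : R -> R -> R) (y z : R) :
  smooth g -> continuity_2d_pt (dy g) y z.
Proof.
  intros H. destruct (H 1%nat y z) as [_ [_ [_ [[H1 _] _]]]]. exact H1.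
Qed.

Lemma smooth_dz_continuous (g : R -> R -> R) (y z : R) :
  smooth g -> continuity_2d_pt (dz g) y z.
Proof.
  intros H. destruct (H 1%nat y z) as [_ [_ [_ [_ [H1 _]]]]]. exact H1.
Qed.

Lemma smooth_is_derive_y (g : R -> R -> R) (y z : R) :
  smooth g -> is_derive (fun u => g u z) y (dy g y z).
Proof.
  intros H. destruct (H 1%nat y z) as [_ [H1 _]]. exact (Derive_correct _ _ H1).
Qed.

Lemma smooth_is_derive_z (g : R -> R -> R) (y z : R) :
  smooth g -> is_derive (fun v => g y v) z (dz g y z).
Proof.
  intros H. destruct (H 1%nat y z) as [_ [_ [H1 _]]].
  exact (Derive_correct _ _ H1).
Qed.

Lemma smooth_differentiable (g : R -> R -> R) (y z : R) :
  smooth g -> differentiable_pt_lim g y z (dy g y z) (dz g y z).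
Proof.
  intros H. apply filterdiff_differentiable_pt_lim.
  apply is_derive_filterdiff.
  - apply filter_forall. intros u. apply smooth_is_derive_y. exact H.
  - apply smooth_is_derive_z. exact H.
  - apply continuity_2d_pt_filterlim. apply smooth_dy_continuous. exact H.
Qed.

Lemma smooth_continuous (g : R -> R -> R) (y z : R) :
  smooth g -> continuity_2d_pt g y z.
Proof. intros H. exact (proj1 (H 0%nat y z)). Qed.

Lemma smooth_derive_along (g : R -> R -> R) (u v : R -> R) (t u' v' : R) :
  smooth g -> is_derive u t u' -> is_derive v t v' ->
  is_derive (fun s => g (u s) (v s)) t (grad_dot g (u t) (v t) u' v').
Proof.
  intros H Hu Hv. apply is_derive_Reals.
  apply derivable_pt_lim_comp_2d.
  - apply smooth_differentiable. exact H.
  - apply is_derive_Reals. exact Hu.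
  - apply is_derive_Reals. exact Hv.
Qed.

(** The chain rule at e = 0 in terms of difference quotients: functions with an expansion are only
    known through limits along [at_right 0], so there is no derivative of [u] and [v] to compose
    with. *)
Lemma differentiable_first_order (g : R -> R -> R) (a b la lb : R)
    (u v : R -> R) (u1 v1 : R) :
  differentiable_pt_lim g a b la lb ->
  filterlim (fun e => (u e - a) / e) (at_right 0) (locally u1) ->
  filterlim (fun e => (v e - b) / e) (at_right 0) (locally v1) ->
  filterlim u (at_right 0) (locally a) ->
  filterlim v (at_right 0) (locally b) ->
  filterlim (fun e => (g (u e) (v e) - g a b) / e) (at_right 0)
    (locally (la * u1 + lb * v1)).
Proof.
  intros Hg Hu1 Hv1 Hu Hv.
  set (p := fun e => (u e - a) / e). set (q := fun e => (v e - b) / e).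
  assert (Hlin : filterlim (fun e => la * p e + lb * q e) (at_right 0)
                   (locally (la * u1 + lb * v1))).
  { apply lim_plus; [exact _| |]; apply lim_mult; try exact _;
      try apply filterlim_const; assumption. }
  assert (Hrem : filterlim
      (fun e => (g (u e) (v e) - g a b) / e - (la * p e + lb * q e))
      (at_right 0) (locally 0)).
  { apply lim_eps; [exact _|]. intros eps He.
    (* Eventually [p e] and [q e] are bounded by [M], so a remainder of relative size
       [eps / (2 * M)] contributes at most [eps / 2] after division by e. *)
    set (M := Rabs u1 + Rabs v1 + 2).
    assert (HM : 0 < M).
    { unfold M. generalize (Rabs_pos u1) (Rabs_pos v1). lra. }
    assert (HeM : 0 < eps / (2 * M)).
    { apply Rdiv_lt_0_compat; lra. }
    destruct (Hg (mkposreal _ HeM)) as [d Hd].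
    generalize (proj1 (lim_eps _ _ _) Hu d (cond_pos d)).
    generalize (proj1 (lim_eps _ _ _) Hv d (cond_pos d)).
    generalize (lim_bounded _ _ _ Hu1). generalize (lim_bounded _ _ _ Hv1).
    generalize at_right_pos.
    do 4 (intros H1 H2; generalize (filter_and _ _ H1 H2); clear H1 H2).
    apply filter_imp. intros e [[[[H0 Hqe] Hpe] Hve] Hue].
    specialize (Hd _ _ Hue Hve). simpl in Hd.
    fold (p e) in Hpe. fold (q e) in Hqe.
    rewrite Rminus_0_r.
    replace ((g (u e) (v e) - g a b) / e - (la * p e + lb * q e)) with
      ((g (u e) (v e) - g a b - (la * (u e - a) + lb * (v e - b))) / e)
      by (unfold p, q; field; lra).
    unfold Rdiv. rewrite Rabs_mult, (Rabs_pos_eq (/ e))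
      by (apply Rlt_le, Rinv_0_lt_compat; exact H0).
    apply Rle_lt_trans with (eps / (2 * M) * (M * e) * / e).
    - apply Rmult_le_compat_r; [apply Rlt_le, Rinv_0_lt_compat; exact H0|].
      apply Rle_trans with (1 := Hd). apply Rmult_le_compat_l; [lra|].
      replace (u e - a) with (p e * e) by (unfold p; field; lra).
      replace (v e - b) with (q e * e) by (unfold q; field; lra).
      rewrite !Rabs_mult, (Rabs_pos_eq e) by lra.
      generalize (Rabs_pos u1) (Rabs_pos v1). intros Pu Pv.
      apply Rmax_lub; apply Rmult_le_compat_r; try lra; unfold M; lra.
    - replace (eps / (2 * M) * (M * e) * / e) with (eps / 2) by (field; lra).
      lra. }
  generalize (lim_plus _ _ _ _ _ Hrem Hlin). rewrite Rplus_0_l.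
  apply filterlim_ext. intros e. fold (p e) (q e). ring.
Qed.

Section Zero_set.

Context (g : R -> R -> R) (c L : R) (g_smooth : smooth g) (c_pos : 0 < c)
  (dz_neg : forall y z, dz g y z < - c)
  (g_lip : forall y1 z1 y2 z2,
    Rabs (g y1 z1 - g y2 z2) <= L * (Rabs (y1 - y2) + Rabs (z1 - z2))).

Lemma lip_pos : 0 <= L.
Proof.
  generalize (g_lip 1 0 0 0) (Rabs_pos (g 1 0 - g 0 0)).
  rewrite !Rminus_0_r, Rabs_R1, Rabs_R0. lra.
Qed.

Lemma dy_bounded (y z : R) : Rabs (dy g y z) <= L.
Proof.
  assert (HL := lip_pos).
  apply le_epsilon. intros eps He.
  destruct (proj1 (is_derive_Reals _ _ _) (smooth_is_derive_y g y z g_smooth)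
    eps He) as [d Hd].
  set (h := d / 2). assert (Hh : 0 < h) by (generalize (cond_pos d); unfold h; lra).
  specialize (Hd h (Rgt_not_eq _ _ Hh)).
  rewrite (Rabs_pos_eq h) in Hd by lra.
  specialize (Hd ltac:(unfold h; generalize (cond_pos d); lra)).
  generalize (g_lip (y + h) z y z). replace (y + h - y) with h by ring.
  replace (z - z) with 0 by ring. rewrite Rabs_R0, (Rabs_pos_eq h) by lra.
  rewrite Rplus_0_r. intros Hl.
  assert (Hq : Rabs ((g (y + h) z - g y z) / h) <= L).
  { unfold Rdiv. rewrite Rabs_mult, (Rabs_pos_eq (/ h))
      by (apply Rlt_le, Rinv_0_lt_compat; exact Hh).
    apply Rmult_le_reg_r with h; [exact Hh|]. rewrite Rmult_assoc, Rinv_l; lra. }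
  replace (dy g y z) with
    ((g (y + h) z - g y z) / h - ((g (y + h) z - g y z) / h - dy g y z)) by ring.
  apply Rle_trans with (1 := Rabs_triang _ _). rewrite Rabs_Ropp. lra.
Qed.

Lemma g_decreasing (y z1 z2 : R) : c * Rabs (z1 - z2) <= Rabs (g y z1 - g y z2).
Proof.
  destruct (MVT_gen (fun v => g y v) z2 z1 (dz g y)) as [x [_ Hx]].
  - intros x _. apply smooth_is_derive_z. exact g_smooth.
  - intros x _. apply derivable_continuous_pt. exists (dz g y x).
    apply is_derive_Reals, smooth_is_derive_z. exact g_smooth.
  - rewrite Hx, Rabs_mult. apply Rmult_le_compat_r; [apply Rabs_pos|].
    generalize (dz_neg y x). intros H. rewrite Rabs_left; lra.
Qed.

Lemma g_has_zero (y : R) : exists z, g y z = 0.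
Proof.
  (* Since the slope in z is below [- c], moving by [r] changes g by at least [Rabs (g y 0)]; hence
     [g y r <= 0 <= g y (- r)]. *)
  set (r := Rabs (g y 0) / c).
  assert (Hr : 0 <= r).
  { apply Rle_mult_inv_pos; [apply Rabs_pos|exact c_pos]. }
  assert (Hcr : c * r = Rabs (g y 0)) by (unfold r; field; lra).
  assert (Hmvt : forall a b, exists x, g y b - g y a = dz g y x * (b - a)).
  { intros a b. destruct (MVT_gen (fun v => g y v) a b (dz g y)) as [x [_ Hx]].
    - intros x _. apply smooth_is_derive_z. exact g_smooth.
    - intros x _. apply derivable_continuous_pt. exists (dz g y x).
      apply is_derive_Reals, smooth_is_derive_z. exact g_smooth.
    - exists x. exact Hx. }
  assert (Habs := Rle_abs (g y 0)). assert (Habs' := Rle_abs (- g y 0)).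
  rewrite Rabs_Ropp in Habs'.
  assert (Hpos : g y r <= 0).
  { destruct (Hmvt 0 r) as [x Hx]. generalize (dz_neg y x). nra. }
  assert (Hneg : 0 <= g y (- r)).
  { destruct (Hmvt (- r) 0) as [x Hx]. generalize (dz_neg y x). nra. }
  destruct (IVT_gen (fun v => g y v) r (- r) 0) as [z [_ Hz]].
  - intros z. apply derivable_continuous_pt. exists (dz g y z).
    apply is_derive_Reals, smooth_is_derive_z. exact g_smooth.
  - split; [apply Rle_trans with (1 := Rmin_l _ _)|
            apply Rle_trans with (2 := Rmax_r _ _)]; assumption.
  - exists z. exact Hz.
Qed.

Context (zeta : R -> R) (zeta_zero : forall y, g y (zeta y) = 0).

(** The tool by which bounds on the defect g become bounds on z: the slope in z is at least [c] in
    absolute value. *)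
Lemma zeta_distance (y z : R) : Rabs (z - zeta y) <= Rabs (g y z) / c.
Proof.
  generalize (g_decreasing y z (zeta y)). rewrite zeta_zero, Rminus_0_r.
  intros H. apply Rmult_le_reg_l with c; [exact c_pos|].
  replace (c * (Rabs (g y z) / c)) with (Rabs (g y z)) by (field; lra). exact H.
Qed.

Lemma zeta_unique (y z : R) : g y z = 0 -> z = zeta y.
Proof.
  intros H. generalize (zeta_distance y z). rewrite H, Rabs_R0.
  unfold Rdiv. rewrite Rmult_0_l. intros H1.
  apply Rminus_diag_uniq. destruct (Req_dec (z - zeta y) 0) as [E|E]; [exact E|].
  generalize (Rabs_pos_lt _ E). lra.
Qed.

(** The point [(y2, zeta y1)] has defect at most [L * Rabs (y1 - y2)], because g vanishes at
    [(y1, zeta y1)]; [zeta_distance] divides this by [c]. *)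
Lemma zeta_lipschitz (y1 y2 : R) :
  Rabs (zeta y1 - zeta y2) <= L / c * Rabs (y1 - y2).
Proof.
  apply Rle_trans with (1 := zeta_distance y2 (zeta y1)).
  rewrite <- (Rminus_0_r (g _ _)), <- (zeta_zero y1).
  generalize (g_lip y2 (zeta y1) y1 (zeta y1)).
  replace (zeta y1 - zeta y1) with 0 by ring. rewrite Rabs_R0, Rplus_0_r.
  rewrite (Rabs_minus_sym y2 y1). intros H.
  apply Rle_trans with (L * Rabs (y1 - y2) / c); [|right; field; lra].
  apply Rmult_le_compat_r; [|exact H]. apply Rlt_le, Rinv_0_lt_compat, c_pos.
Qed.

Lemma zeta_continuous (y : R) : continuity_pt zeta y.
Proof.
  assert (HL := lip_pos).
  assert (Hq : 0 <= L / c) by (apply Rle_mult_inv_pos; assumption).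
  apply continuity_pt_filterlim. apply lim_eps; [exact _|].
  intros eps He.
  (* The added 1 keeps the denominator positive when [L = 0]. *)
  assert (Hd : 0 < eps / (L / c + 1)) by (apply Rdiv_lt_0_compat; lra).
  exists (mkposreal _ Hd). intros x Hx.
  change (Rabs (x - y) < eps / (L / c + 1)) in Hx.
  apply Rle_lt_trans with (1 := zeta_lipschitz x y).
  apply Rle_lt_trans with ((L / c + 1) * Rabs (x - y)).
  - generalize (Rabs_pos (x - y)). nra.
  - apply Rmult_lt_reg_r with (/ (L / c + 1));
      [apply Rinv_0_lt_compat; lra|].
    apply Rle_lt_trans with (2 := Hx). right. field. split; lra.
Qed.

End Zero_set.

(** * The limit e -> 0 with fixed step size *)

Lemma hilbert_order0 (u : R -> R) (a : nat -> R) :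
  hilbert_expansion u a -> filterlim u (at_right 0) (locally (a 0%nat)).
Proof.
  intros H. apply lim_eps; [exact _|]. intros eps He.
  assert (He2 : 0 < eps / 2) by lra.
  generalize (H 0%nat (mkposreal _ He2)). apply filter_imp. intros e.
  rewrite sum_O. change (Rabs (u e - a 0%nat * e ^ 0) <= eps / 2 * Rabs (e ^ 0)
    -> Rabs (u e - a 0%nat) < eps).
  rewrite pow_O, Rabs_R1, !Rmult_1_r. lra.
Qed.

(** The remainder of the expansion up to order 1 is o(e), and division by [e > 0] turns it into
    o(1). *)
Lemma hilbert_order1 (u : R -> R) (a : nat -> R) :
  hilbert_expansion u a ->
  filterlim (fun e => (u e - a 0%nat) / e) (at_right 0) (locally (a 1%nat)).
Proof.
  intros H. apply lim_eps; [exact _|]. intros eps He.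
  assert (He2 : 0 < eps / 2) by lra.
  generalize (H 1%nat (mkposreal _ He2)) at_right_pos.
  apply filter_imp2; [exact _|]. intros e.
  rewrite sum_Sn, sum_O.
  change (Rabs (u e - (a 0%nat * e ^ 0 + a 1%nat * e ^ 1))
    <= eps / 2 * Rabs (e ^ 1) -> 0 < e -> Rabs ((u e - a 0%nat) / e - a 1%nat) < eps).
  rewrite pow_O, pow_1, Rmult_1_r. intros H1 H0.
  replace ((u e - a 0%nat) / e - a 1%nat) with
    ((u e - (a 0%nat + a 1%nat * e)) / e) by (field; lra).
  unfold Rdiv. rewrite Rabs_mult, (Rabs_pos_eq (/ e))
    by (apply Rlt_le, Rinv_0_lt_compat; exact H0).
  rewrite (Rabs_pos_eq e) in H1 by lra.
  apply Rle_lt_trans with (eps / 2 * e * / e).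
  - apply Rmult_le_compat_r; [apply Rlt_le, Rinv_0_lt_compat; exact H0|exact H1].
  - rewrite Rmult_assoc, Rinv_r; lra.
Qed.

Section Limit_scheme.

Context (g : R -> R -> R) (zeta : R -> R).

(* Along Y' = zeta (Y) this is the derivative of Z = zeta (Y). *)
Definition zeta_rate (a : R) : R :=
  - (dy g a (zeta a) * zeta a) / dz g a (zeta a).

(** The y-equations of predictor and corrector with z replaced by [zeta] and g / e by [zeta_rate].
    The implicit z-equations survive only as the constraint z = [zeta] (y). *)
Fixpoint limit_stage (dt a : R) (k : nat) : R :=
  match k with
  | O => a + dt * zeta a + dt ^ 2 / 2 * zeta_rate a
  | S k => let b := limit_stage dt a k in
      a + dt / 2 * (zeta a + zeta b) + dt ^ 2 / 12 * (zeta_rate a - zeta_rate b)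
  end.

(* The weak form of well-preparedness inherited by every stage: it needs no
   expansion in e. *)
Definition settles (u v : R -> R) (a : R) : Prop :=
  filterlim u (at_right 0) (locally a) /\
  filterlim v (at_right 0) (locally (zeta a)) /\
  filterlim (fun e => gdot g e (u e) (v e)) (at_right 0) (locally 0).

Context (c L : R) (g_smooth : smooth g) (c_pos : 0 < c)
  (dz_neg : forall y z, dz g y z < - c)
  (g_lip : forall y1 z1 y2 z2,
    Rabs (g y1 z1 - g y2 z2) <= L * (Rabs (y1 - y2) + Rabs (z1 - z2)))
  (zeta_zero : forall y, g y (zeta y) = 0).

Lemma settles_g (u v : R -> R) (a : R) :
  settles u v a -> filterlim (fun e => g (u e) (v e)) (at_right 0) (locally 0).
Proof.
  intros [Hu [Hv _]].
  generalize (lim_2d _ g u v _ _ (smooth_continuous g _ _ g_smooth) Hu Hv).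
  rewrite zeta_zero. tauto.
Qed.

(** [gdot] is affine in [1 / e * g] with slope [dz g]. As this slope has a nonzero limit, the
    convergence of [gdot] to 0 can be solved for [1 / e * g]. *)
Lemma settles_rate (u v : R -> R) (a : R) :
  settles u v a ->
  filterlim (fun e => 1 / e * g (u e) (v e)) (at_right 0)
    (locally (zeta_rate a)).
Proof.
  intros [Hu [Hv Hd]].
  assert (Hy := lim_2d _ (dy g) u v _ _ (smooth_dy_continuous g _ _ g_smooth) Hu Hv).
  assert (Hz := lim_2d _ (dz g) u v _ _ (smooth_dz_continuous g _ _ g_smooth) Hu Hv).
  assert (Hn : dz g a (zeta a) <> 0) by (generalize (dz_neg a (zeta a)); lra).
  assert (H := lim_mult _ _ _ _ _ (lim_minus _ _ _ _ _ Hd (lim_mult _ _ _ _ _ Hy Hv))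
    (lim_inv _ _ _ Hn Hz)).
  replace (zeta_rate a) with
    ((0 - dy g a (zeta a) * zeta a) * / dz g a (zeta a))
    by (unfold zeta_rate; field; exact Hn).
  revert H. apply filterlim_ext. intros e. unfold gdot, grad_dot.
  generalize (1 / e). intros i. field.
  generalize (dz_neg (u e) (v e)). lra.
Qed.

Lemma settles_of_rate (u v : R -> R) (a r : R) :
  filterlim u (at_right 0) (locally a) ->
  filterlim v (at_right 0) (locally (zeta a)) ->
  filterlim (fun e => 1 / e * g (u e) (v e)) (at_right 0) (locally r) ->
  grad_dot g a (zeta a) (zeta a) r = 0 ->
  settles u v a.
Proof.
  intros Hu Hv Hr H0. split; [exact Hu|]. split; [exact Hv|].
  assert (Hy := lim_2d _ (dy g) u v _ _ (smooth_dy_continuous g _ _ g_smooth) Hu Hv).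
  assert (Hz := lim_2d _ (dz g) u v _ _ (smooth_dz_continuous g _ _ g_smooth) Hu Hv).
  generalize
    (lim_plus _ _ _ _ _ (lim_mult _ _ _ _ _ Hy Hv) (lim_mult _ _ _ _ _ Hz Hr)).
  fold (grad_dot g a (zeta a) (zeta a) r). rewrite H0. tauto.
Qed.

(** The common form of all implicit z-equations after multiplication by e, with the explicit terms
    collected in [r]. Multiplying by e once more isolates [dz g * g] and bounds g by a multiple of
    e; then [v] follows [u] to the graph of [zeta], and the equation itself returns [gdot -> 0]. *)
Lemma settles_implicit (dt : R) (u v r : R -> R) (a : R) :
  0 < dt ->
  filterlim u (at_right 0) (locally a) ->
  filterlim r (at_right 0) (locally 0) ->
  at_right 0 (fun e => dt ^ 2 / 2 * gdot g e (u e) (v e) =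
    dt * g (u e) (v e) - e * v e + r e) ->
  settles u v a.
Proof.
  intros Hdt Hu Hr Heq.
  assert (HL := lip_pos g L g_lip).
  (* Once [u e] is within 1 of [a], the Lipschitz bound on [zeta] gives [Rabs (v e) <= M + G / c],
     where [G] is the size of the defect. *)
  set (M := Rabs (zeta a) + 1 + L / c).
  assert (HM : 1 <= M).
  { unfold M. generalize (Rabs_pos (zeta a)) (Rle_mult_inv_pos _ _ HL c_pos).
    unfold Rdiv. lra. }
  (* Since dz g < -c, the leading term dt^2 / (2 e) * dz g * g of the implicit
     equation controls g by e * (1 + |v|), while |v| is controlled by g. *)
  set (K := 2 / (c * dt ^ 2) * ((dt ^ 2 / 2 * L + 1) * M + 1)).
  assert (Hcd : 0 < c * dt ^ 2).
  { apply Rmult_lt_0_compat; [exact c_pos|]. apply pow_lt, Hdt. }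
  assert (HK : 0 <= K).
  { unfold K. apply Rmult_le_pos.
    - apply Rlt_le, Rdiv_lt_0_compat; lra.
    - assert (0 <= dt ^ 2 / 2 * L * M); [|nra].
      apply Rmult_le_pos; [|lra]. apply Rmult_le_pos; [nra|exact HL]. }
  (* For [e < d] the terms with [G] on the right of [HG2] are at most [c * dt ^ 2 / 4 * G], half of
     the left side, and are absorbed. *)
  set (q := dt + (dt ^ 2 / 2 * L + 1) / c + 1). set (d := c * dt ^ 2 / (4 * q)).
  assert (Hden : 0 < q).
  { assert (0 < (dt ^ 2 / 2 * L + 1) / c); [|unfold q; lra].
    apply Rdiv_lt_0_compat; [nra|exact c_pos]. }
  assert (Hd : 0 < d) by (apply Rdiv_lt_0_compat; lra).
  assert (Hbound : at_right 0 (fun e => Rabs (g (u e) (v e)) <= 2 * K * e)).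
  { generalize (proj1 (lim_eps _ _ _) Hr 1 Rlt_0_1).
    generalize (proj1 (lim_eps _ _ _) Hu 1 Rlt_0_1).
    generalize (at_right_lt d Hd) (at_right_lt 1 Rlt_0_1) at_right_pos Heq.
    do 5 (intros H1 H2; generalize (filter_and _ _ H1 H2); clear H1 H2).
    apply filter_imp. intros e [[[[[H2 H3] H4] H1] H5] H6].
    rewrite Rminus_0_r in H6.
    set (G := Rabs (g (u e) (v e))).
    assert (HG : 0 <= G) by apply Rabs_pos.
    assert (Hv : Rabs (v e) <= M + G / c).
    { assert (D1 := zeta_distance g c g_smooth c_pos dz_neg zeta zeta_zero (u e) (v e)).
      assert (D2 := zeta_lipschitz g c L g_smooth c_pos dz_neg g_lip zeta zeta_zero (u e) a).
      fold G in D1.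
      assert (D3 : L / c * Rabs (u e - a) <= L / c).
      { rewrite <- (Rmult_1_r (L / c)) at 2. apply Rmult_le_compat_l; [|lra].
        apply Rle_mult_inv_pos; assumption. }
      replace (v e) with ((v e - zeta (u e)) + (zeta (u e) - zeta a) + zeta a) by ring.
      generalize (Rabs_triang (v e - zeta (u e) + (zeta (u e) - zeta a)) (zeta a))
        (Rabs_triang (v e - zeta (u e)) (zeta (u e) - zeta a)).
      unfold M. lra. }
    assert (Hy := dy_bounded g L g_smooth g_lip (u e) (v e)).
    assert (Hz := dz_neg (u e) (v e)).
    assert (HG1 : c * dt ^ 2 / 2 * G <=
      e * (dt * G + (dt ^ 2 / 2 * L + 1) * Rabs (v e) + 1)).
    { assert (E : dt ^ 2 / 2 * (dz g (u e) (v e) * g (u e) (v e)) =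
        e * (dt * g (u e) (v e) - e * v e + r e
             - dt ^ 2 / 2 * (dy g (u e) (v e) * v e))).
      { rewrite <- H1. unfold gdot, grad_dot. field. lra. }
      apply Rle_trans with (Rabs (dt ^ 2 / 2 * (dz g (u e) (v e) * g (u e) (v e)))).
      - rewrite !Rabs_mult. fold G. rewrite (Rabs_pos_eq (dt ^ 2 / 2)) by nra.
        rewrite (Rabs_left (dz g _ _)) by lra.
        assert (Hp : 0 <= dt ^ 2 / 2 * G) by (apply Rmult_le_pos; nra). nra.
      - rewrite E, Rabs_mult, (Rabs_pos_eq e) by lra.
        apply Rmult_le_compat_l; [lra|].
        assert (T1 : Rabs (dt * g (u e) (v e)) = dt * G)
          by (rewrite Rabs_mult, (Rabs_pos_eq dt); [reflexivity|lra]).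
        assert (T2 : Rabs (e * v e) <= Rabs (v e)).
        { rewrite Rabs_mult, (Rabs_pos_eq e) by lra.
          generalize (Rabs_pos (v e)). nra. }
        assert (T3 : Rabs (dt ^ 2 / 2 * (dy g (u e) (v e) * v e))
                     <= dt ^ 2 / 2 * L * Rabs (v e)).
        { rewrite !Rabs_mult, (Rabs_pos_eq (dt ^ 2 / 2)) by nra.
          rewrite Rmult_assoc. apply Rmult_le_compat_l; [nra|].
          apply Rmult_le_compat_r; [apply Rabs_pos|exact Hy]. }
        unfold Rminus at 1 2.
        generalize (Rabs_triang (dt * g (u e) (v e) + - (e * v e) + r e)
            (- (dt ^ 2 / 2 * (dy g (u e) (v e) * v e))))
          (Rabs_triang (dt * g (u e) (v e) + - (e * v e)) (r e))
          (Rabs_triang (dt * g (u e) (v e)) (- (e * v e))).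
        rewrite !Rabs_Ropp. lra. }
    assert (HLd : 0 <= dt ^ 2 / 2 * L + 1).
    { assert (0 <= dt ^ 2 / 2 * L); [apply Rmult_le_pos; nra|lra]. }
    assert (HG2 : c * dt ^ 2 / 2 * G <=
      e * (dt + (dt ^ 2 / 2 * L + 1) / c) * G + e * ((dt ^ 2 / 2 * L + 1) * M + 1)).
    { apply Rle_trans with (1 := HG1).
      apply Rle_trans with
        (e * (dt * G + (dt ^ 2 / 2 * L + 1) * (M + G / c) + 1)).
      - apply Rmult_le_compat_l; [lra|]. apply Rplus_le_compat_r, Rplus_le_compat_l.
        apply Rmult_le_compat_l; assumption.
      - right. field. lra. }
    assert (HG3 : e * (dt + (dt ^ 2 / 2 * L + 1) / c) <= c * dt ^ 2 / 4).
    { apply Rle_trans with (e * q); [apply Rmult_le_compat_l; unfold q; lra|].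
      apply Rle_trans with (d * q); [apply Rmult_le_compat_r; lra|].
      right. unfold d. field. lra. }
    apply Rmult_le_reg_l with (c * dt ^ 2 / 4); [lra|].
    apply Rle_trans with (e * ((dt ^ 2 / 2 * L + 1) * M + 1)).
    - assert (HG4 := Rmult_le_compat_r G _ _ HG HG3). lra.
    - right. unfold K. field. split; lra. }
  assert (Hlin : filterlim (fun e => 2 * K * e) (at_right 0) (locally 0)).
  { generalize (lim_mult _ _ _ _ _ (filterlim_const (2 * K)) at_right_id).
    rewrite Rmult_0_r. tauto. }
  assert (Hg0 : filterlim (fun e => g (u e) (v e)) (at_right 0) (locally 0)).
  { apply lim_squeeze with (fun e => 2 * K * e); [exact _| |exact Hlin].
    revert Hbound. apply filter_imp. intros e. rewrite Rminus_0_r. tauto. }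
  assert (Hv : filterlim v (at_right 0) (locally (zeta a))).
  { apply lim_squeeze with
      (fun e => Rabs (g (u e) (v e)) * / c + L / c * Rabs (u e - a)); [exact _| |].
    - apply filter_forall. intros e.
      assert (D1 := zeta_distance g c g_smooth c_pos dz_neg zeta zeta_zero (u e) (v e)).
      assert (D2 := zeta_lipschitz g c L g_smooth c_pos dz_neg g_lip zeta zeta_zero (u e) a).
      replace (v e - zeta a) with ((v e - zeta (u e)) + (zeta (u e) - zeta a)) by ring.
      apply Rle_trans with (1 := Rabs_triang _ _).
      apply Rplus_le_compat; assumption.
    - apply lim_eq with (0 * / c + L / c * 0); [ring|].
      apply lim_plus; [exact _| |]; (apply lim_mult; [exact _| |]);
        try apply filterlim_const.
      + exact (proj1 (lim_abs_0 _ _) Hg0).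
      + apply (proj1 (lim_abs_0 _ _)). apply lim_eq with (a - a); [ring|].
        apply lim_minus; [exact _|exact Hu|apply filterlim_const]. }
  split; [exact Hu|]. split; [exact Hv|].
  (* With g and [v] under control, the equation solved for [gdot] yields the third condition of
     [settles]. *)
  assert (Hrhs : filterlim (fun e => 2 / dt ^ 2 * (dt * g (u e) (v e) - e * v e + r e))
    (at_right 0) (locally 0)).
  { apply lim_eq with (2 / dt ^ 2 * (dt * 0 - 0 * zeta a + 0)); [ring|].
    limits. apply at_right_id. }
  revert Hrhs. apply filterlim_ext_loc.
  revert Heq. apply filter_imp. intros e <-. field. lra.
Qed.

Lemma settles_predictor (dt : R) (yn zn y z : R -> R) (a : R) :
  0 < dt -> settles yn zn a ->
  at_right 0 (fun e => predictor g e dt (yn e) (zn e) (y e) (z e)) ->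
  settles y z (limit_stage dt a 0).
Proof.
  intros Hdt Hn Hp.
  assert (Hr := settles_rate _ _ _ Hn). destruct Hn as [Hy [Hz Hd]].
  apply (settles_implicit dt) with (r := fun e => e * zn e); [exact Hdt| | |].
  - assert (H : filterlim
      (fun e => yn e + dt * zn e + dt ^ 2 / 2 * (1 / e * g (yn e) (zn e)))
      (at_right 0) (locally (limit_stage dt a 0))).
    { cbn [limit_stage]. limits. }
    revert H. apply filterlim_ext_loc.
    generalize Hp at_right_pos. apply filter_imp2; [exact _|].
    intros e [E _] He. rewrite E. field. lra.
  - apply lim_eq with (0 * zeta a); [ring|].
    apply lim_mult; [exact _|exact at_right_id|exact Hz].
  - generalize Hp at_right_pos. apply filter_imp2; [exact _|].
    intros e [_ E] He.
    assert (E' : e * z e = e * (zn e + dt / e * g (y e) (z e)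
      - dt ^ 2 / (2 * e) * gdot g e (y e) (z e))) by (rewrite <- E; reflexivity).
    replace (e * (zn e + dt / e * g (y e) (z e)
      - dt ^ 2 / (2 * e) * gdot g e (y e) (z e))) with
      (e * zn e + dt * g (y e) (z e) - dt ^ 2 / 2 * gdot g e (y e) (z e))
      in E' by (field; lra).
    lra.
Qed.

(** All explicit terms, multiplied by e, go into [r]. They vanish in the limit because the values of
    g and [gdot] at the start of the step and at the previous stage do; this is why [settles] has to
    record [gdot -> 0]. *)
Lemma settles_corrector (dt : R) (yn zn yk zk y z : R -> R) (a : R) (k : nat) :
  0 < dt -> settles yn zn a -> settles yk zk (limit_stage dt a k) ->
  at_right 0
    (fun e => corrector g e dt (yn e) (zn e) (yk e) (zk e) (y e) (z e)) ->
  settles y z (limit_stage dt a (S k)).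
Proof.
  intros Hdt Hn Hk Hp.
  assert (Hrn := settles_rate _ _ _ Hn). assert (Hrk := settles_rate _ _ _ Hk).
  assert (Hgn := settles_g _ _ _ Hn). assert (Hgk := settles_g _ _ _ Hk).
  destruct Hn as [Hyn [Hzn Hdn]]. destruct Hk as [Hyk [Hzk Hdk]].
  apply (settles_implicit dt) with (r := fun e =>
    e * zn e - dt * g (yk e) (zk e) + dt ^ 2 / 2 * gdot g e (yk e) (zk e)
    + dt / 2 * (g (yn e) (zn e) + g (yk e) (zk e))
    + dt ^ 2 / 12 * (gdot g e (yn e) (zn e) - gdot g e (yk e) (zk e)));
    [exact Hdt| | |].
  - assert (H : filterlim (fun e => yn e + dt / 2 * (zn e + zk e)
      + dt ^ 2 / 12 * (1 / e * g (yn e) (zn e) - 1 / e * g (yk e) (zk e)))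
      (at_right 0) (locally (limit_stage dt a (S k)))).
    { cbn [limit_stage]. limits. }
    revert H. apply filterlim_ext_loc.
    generalize Hp at_right_pos. apply filter_imp2; [exact _|].
    intros e [E _] He. rewrite E. field. lra.
  - apply lim_eq with (0 * zeta a - dt * 0 + dt ^ 2 / 2 * 0 + dt / 2 * (0 + 0)
      + dt ^ 2 / 12 * (0 - 0)); [ring|].
    limits. exact at_right_id.
  - generalize Hp at_right_pos. apply filter_imp2; [exact _|].
    (* The third occurrence of [z e] is the one in [e * z e]; those inside [gdot] and g stay. *)
    intros e [_ E] He. rewrite E at 3. field. lra.
Qed.

Lemma settles_step (kmax : nat) (dt : R) (yn zn y z : R -> R) (a : R) :
  0 < dt -> settles yn zn a ->
  at_right 0 (fun e => one_step g kmax e dt (yn e) (zn e) (y e) (z e)) ->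
  settles y z (limit_stage dt a kmax).
Proof.
  intros Hdt Hn Hstep.
  (* The stages exist separately for each e. Choice turns them into functions of e, with an
     arbitrary value where no step exists, so that limits in e can be taken stage by stage. *)
  set (stages := fun (e : R) (s : (nat -> R) * (nat -> R)) =>
    one_step g kmax e dt (yn e) (zn e) (y e) (z e) ->
    predictor g e dt (yn e) (zn e) (fst s 0%nat) (snd s 0%nat) /\
    (forall k : nat, (k < kmax)%nat ->
       corrector g e dt (yn e) (zn e) (fst s k) (snd s k)
         (fst s (S k)) (snd s (S k))) /\
    y e = fst s kmax /\ z e = snd s kmax).
  destruct (functional_choice stages) as [s Hs].
  { intros e. destruct (Classical_Prop.classic
      (one_step g kmax e dt (yn e) (zn e) (y e) (z e))) as [H|H].
    - destruct H as [ys [zs H]]. exists (ys, zs). intros _. exact H.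
    - exists (fun _ => 0, fun _ => 0). intros H'. contradiction. }
  assert (Hstage : forall k, (k <= kmax)%nat ->
    settles (fun e => fst (s e) k) (fun e => snd (s e) k) (limit_stage dt a k)).
  { induction k as [|k IH]; intros Hk.
    - apply (settles_predictor dt yn zn); [exact Hdt|exact Hn|].
      revert Hstep. apply filter_imp. intros e He. exact (proj1 (Hs e He)).
    - apply (settles_corrector dt yn zn (fun e => fst (s e) k) (fun e => snd (s e) k));
        [exact Hdt|exact Hn|apply IH; lia|].
      revert Hstep. apply filter_imp. intros e He.
      apply (proj1 (proj2 (Hs e He))). lia. }
  destruct (Hstage kmax (le_n _)) as [H1 [H2 H3]].
  assert (Heq : at_right 0 (fun e => y e = fst (s e) kmax /\ z e = snd (s e) kmax)).
  { revert Hstep. apply filter_imp. intros e He. apply (Hs e He). }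
  split; [|split]; [revert H1|revert H2|revert H3]; apply filterlim_ext_loc;
    revert Heq; apply filter_imp; intros e [E1 E2]; rewrite ?E1, ?E2; reflexivity.
Qed.

(** * Expansions, well-preparedness and iteration over the time levels *)

Lemma expansion_rate (u v : R -> R) (a b : nat -> R) :
  hilbert_expansion u a -> hilbert_expansion v b ->
  g (a 0%nat) (b 0%nat) = 0 ->
  filterlim (fun e => 1 / e * g (u e) (v e)) (at_right 0)
    (locally (grad_dot g (a 0%nat) (b 0%nat) (a 1%nat) (b 1%nat))).
Proof.
  intros Ha Hb H0.
  generalize (differentiable_first_order g _ _ _ _ u v _ _
    (smooth_differentiable g (a 0%nat) (b 0%nat) g_smooth)
    (hilbert_order1 _ _ Ha) (hilbert_order1 _ _ Hb)
    (hilbert_order0 _ _ Ha) (hilbert_order0 _ _ Hb)).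
  apply filterlim_ext. intros e. rewrite H0. unfold Rdiv. ring.
Qed.

Lemma prepared_settles (u v : R -> R) (a b : nat -> R) :
  hilbert_expansion u a -> hilbert_expansion v b ->
  g (a 0%nat) (b 0%nat) = 0 ->
  grad_dot g (a 0%nat) (b 0%nat) (b 0%nat)
    (grad_dot g (a 0%nat) (b 0%nat) (a 1%nat) (b 1%nat)) = 0 ->
  settles u v (a 0%nat).
Proof.
  intros Ha Hb H0 H1.
  assert (Eb := zeta_unique g c g_smooth c_pos dz_neg zeta zeta_zero _ _ H0).
  apply settles_of_rate with
    (grad_dot g (a 0%nat) (b 0%nat) (a 1%nat) (b 1%nat)).
  - exact (hilbert_order0 _ _ Ha).
  - rewrite <- Eb. exact (hilbert_order0 _ _ Hb).
  - exact (expansion_rate _ _ _ _ Ha Hb H0).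
  - rewrite <- Eb. exact H1.
Qed.

(** The limit of [1 / e * g] is computed twice, from the expansions and as [zeta_rate]. Uniqueness
    of limits equates the two, and for [zeta_rate] the second condition holds by construction. *)
Lemma settles_prepared (u v : R -> R) (x : R) (a b : nat -> R) :
  settles u v x -> hilbert_expansion u a -> hilbert_expansion v b ->
  g (a 0%nat) (b 0%nat) = 0 /\
  grad_dot g (a 0%nat) (b 0%nat) (b 0%nat)
    (grad_dot g (a 0%nat) (b 0%nat) (a 1%nat) (b 1%nat)) = 0.
Proof.
  intros Hs Ha Hb. assert (Hrate := settles_rate _ _ _ Hs).
  destruct Hs as [Hu [Hv Hd]].
  assert (Ea := filterlim_locally_unique (V := R_NormedModule) _ _ _
    (hilbert_order0 _ _ Ha) Hu).
  assert (Eb := filterlim_locally_unique (V := R_NormedModule) _ _ _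
    (hilbert_order0 _ _ Hb) Hv).
  assert (H0 : g (a 0%nat) (b 0%nat) = 0) by (rewrite Ea, Eb; apply zeta_zero).
  split; [exact H0|].
  assert (E := filterlim_locally_unique (V := R_NormedModule) _ _ _
    (expansion_rate _ _ _ _ Ha Hb H0) Hrate).
  rewrite E, Ea, Eb. unfold grad_dot, zeta_rate. field.
  generalize (dz_neg x (zeta x)). lra.
Qed.

Definition limit_iterate (kmax : nat) (dt a : R) (n : nat) : R :=
  Nat.iter n (fun b => limit_stage dt b kmax) a.

Lemma settles_iterate (kmax : nat) (dt : R) (N : nat) (y z : R -> nat -> R) (a : R) :
  0 < dt ->
  at_right 0 (fun e => numerical_solution g kmax e dt N (y e) (z e)) ->
  settles (fun e => y e 0%nat) (fun e => z e 0%nat) a ->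
  forall n, (n <= N)%nat ->
  settles (fun e => y e n) (fun e => z e n) (limit_iterate kmax dt a n).
Proof.
  intros Hdt Hnum H0. induction n as [|n IH]; intros Hn; [exact H0|].
  apply (settles_step kmax dt (fun e => y e n) (fun e => z e n));
    [exact Hdt|apply IH; lia|].
  revert Hnum. apply filter_imp. intros e He. apply He. lia.
Qed.

End Limit_scheme.

(** * First-order one-step methods for planar systems *)

Lemma continuous_bounded (f : R -> R) (T : R) :
  0 <= T -> (forall s, 0 <= s <= T -> continuity_pt f s) ->
  exists M, 0 <= M /\ forall s, 0 <= s <= T -> Rabs (f s) <= M.
Proof.
  intros HT Hf.
  destruct (continuity_ab_maj (fun s => Rabs (f s)) 0 T HT) as [m [Hm _]].
  - intros s Hs. apply (continuity_pt_comp f Rabs); [exact (Hf s Hs)|].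
    apply Rcontinuity_abs.
  - exists (Rabs (f m)). split; [apply Rabs_pos|exact Hm].
Qed.

Lemma mean_value (f f' : R -> R) (T s t : R) :
  (forall s, 0 <= s <= T -> continuity_pt f s) ->
  (forall s, 0 < s < T -> is_derive f s (f' s)) ->
  0 <= s -> s <= t -> t <= T ->
  exists x, s <= x <= t /\ f t - f s = f' x * (t - s).
Proof.
  intros Hc Hd Hs Hst Ht.
  destruct (MVT_gen f s t f') as [x Hx].
  - rewrite Rmin_left, Rmax_right by exact Hst. intros x Hx. apply Hd. lra.
  - rewrite Rmin_left, Rmax_right by exact Hst. intros x Hx. apply Hc. lra.
  - rewrite Rmin_left, Rmax_right in Hx by exact Hst. exists x. exact Hx.
Qed.

(** The weight [exp (- A * s)] makes [f + B / A] nonincreasing. [A] may be negative: the decay of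
    the defect uses [A = - (c / e)]. The inequality for [f'] includes the endpoints because the
    intermediate point of [mean_value] may be one of them. *)
Lemma gronwall (f f' : R -> R) (T A B : R) :
  A <> 0 ->
  (forall s, 0 <= s <= T -> continuity_pt f s) ->
  (forall s, 0 < s < T -> is_derive f s (f' s)) ->
  (forall s, 0 <= s <= T -> f' s <= A * f s + B) ->
  forall t, 0 <= t <= T -> f t <= (f 0 + B / A) * exp (A * t) - B / A.
Proof.
  intros HA Hc Hd Hle t Ht.
  destruct (mean_value (fun s => (f s + B / A) * exp (- A * s))
    (fun s => (f' s - (A * f s + B)) * exp (- A * s)) T 0 t) as [x [Hx E]]; try lra.
  - intros s Hs. apply continuity_pt_mult.
    + apply continuity_pt_plus; [exact (Hc s Hs)|].
      apply continuity_pt_const. intros a b. reflexivity.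
    + apply derivable_continuous_pt, ex_derive_Reals_0. auto_derive. exact I.
  - intros s Hs. assert (Hs' := Hd s Hs).
    auto_derive; [exists (f' s); exact Hs'|].
    replace (Derive (fun x : R => f x) s) with (f' s)
      by (symmetry; apply is_derive_unique; exact Hs'). field. exact HA.
  - rewrite Rmult_0_r, exp_0, Rmult_1_r, Rminus_0_r in E.
    assert (Hneg : (f t + B / A) * exp (- A * t) <= f 0 + B / A).
    { assert (P := exp_pos (- A * x)). specialize (Hle x).
      assert (0 <= (A * f x + B - f' x) * exp (- A * x) * t); [|lra].
      repeat apply Rmult_le_pos; lra. }
    apply (Rmult_le_compat_r (exp (A * t)) _ _ (Rlt_le _ _ (exp_pos _))) in Hneg.
    rewrite Rmult_assoc, <- exp_plus in Hneg.
    replace (- A * t + A * t) with 0 in Hneg by ring.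
    rewrite exp_0, Rmult_1_r in Hneg. lra.
Qed.

(** Shifting [E] by [B / a * dt] absorbs the inhomogeneity, so that each step only multiplies by
    [1 + a * dt <= exp (a * dt)]. *)
Lemma discrete_gronwall (E : nat -> R) (a B dt T : R) (N : nat) :
  0 < a -> 0 <= B -> 0 < dt -> INR N * dt <= T -> E 0%nat = 0 ->
  (forall n, (n < N)%nat -> E (S n) <= (1 + a * dt) * E n + B * dt ^ 2) ->
  forall n, (n <= N)%nat -> E n <= exp (a * T) * (B / a) * dt.
Proof.
  intros Ha HB Hdt HT H0 Hstep n Hn.
  assert (HBa : 0 <= B / a) by (apply Rle_mult_inv_pos; assumption).
  assert (Hexp : forall n, (n <= N)%nat ->
    E n + B / a * dt <= exp (a * (INR n * dt)) * (B / a * dt)).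
  { clear n Hn. induction n as [|n IH]; intros Hn.
    - rewrite H0. simpl INR. rewrite Rmult_0_l, Rmult_0_r, exp_0. lra.
    - specialize (IH ltac:(lia)). specialize (Hstep n ltac:(lia)).
      apply Rle_trans with ((1 + a * dt) * (E n + B / a * dt)).
      + apply Rle_trans with ((1 + a * dt) * E n + B * dt ^ 2 + B / a * dt); [lra|].
        right. field. lra.
      + apply Rle_trans with
          ((1 + a * dt) * (exp (a * (INR n * dt)) * (B / a * dt))).
        * apply Rmult_le_compat_l; [nra|exact IH].
        * rewrite S_INR, <- Rmult_assoc. apply Rmult_le_compat_r; [nra|].
          replace (a * ((INR n + 1) * dt)) with (a * dt + a * (INR n * dt)) by ring.
          rewrite exp_plus. apply Rmult_le_compat_r; [apply Rlt_le, exp_pos|].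
          apply Rlt_le. destruct (Rtotal_order (a * dt) 0) as [C|[C|C]];
            [nra|rewrite C, exp_0; nra|apply exp_ineq1; lra]. }
  specialize (Hexp n Hn).
  assert (Hle : exp (a * (INR n * dt)) <= exp (a * T)).
  { apply le_INR in Hn.
    assert (a * (INR n * dt) <= a * T) as [C|C];
      [apply Rmult_le_compat_l; [lra|nra]
      |apply Rlt_le, exp_increasing, C|rewrite C; lra]. }
  assert (Hp : 0 <= B / a * dt) by nra.
  apply (Rmult_le_compat_r _ _ _ Hp) in Hle. lra.
Qed.

Definition lipschitz2 (K : R) (F : R -> R -> R) : Prop :=
  forall a b a' b', Rabs (F a b - F a' b') <= K * (Rabs (a - a') + Rabs (b - b')).

(** [continuity_pt] at 0 and [T] looks beyond the interval, so a solution given on [0, T] has to be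
    extended before it fits here. *)
Definition solves (F1 F2 : R -> R -> R) (T : R) (y z : R -> R) : Prop :=
  (forall s, 0 <= s <= T -> continuity_pt y s) /\
  (forall s, 0 <= s <= T -> continuity_pt z s) /\
  (forall s, 0 < s < T -> is_derive y s (F1 (y s) (z s))) /\
  (forall s, 0 < s < T -> is_derive z s (F2 (y s) (z s))).

Section System.

Context (F1 F2 : R -> R -> R) (K T : R) (y z : R -> R) (K_pos : 0 <= K)
  (T_pos : 0 < T) (F1_lip : lipschitz2 K F1) (F2_lip : lipschitz2 K F2)
  (sol : solves F1 F2 T y z).

Lemma lipschitz2_growth (F : R -> R -> R) (a b : R) :
  lipschitz2 K F -> Rabs (F a b) <= Rabs (F 0 0) + K * (Rabs a + Rabs b).
Proof.
  intros H. generalize (H a b 0 0). rewrite !Rminus_0_r.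
  replace (F a b) with (F 0 0 + (F a b - F 0 0)) at 2 by ring.
  generalize (Rabs_triang (F 0 0) (F a b - F 0 0)). lra.
Qed.

Lemma solution_bounded :
  exists M, 0 <= M /\ forall s, 0 <= s <= T -> Rabs (y s) + Rabs (z s) <= M.
Proof.
  destruct sol as [Hy [Hz _]].
  destruct (continuous_bounded y T (Rlt_le _ _ T_pos) Hy) as [M1 [P1 H1]].
  destruct (continuous_bounded z T (Rlt_le _ _ T_pos) Hz) as [M2 [P2 H2]].
  exists (M1 + M2). split; [lra|]. intros s Hs.
  generalize (H1 s Hs) (H2 s Hs). lra.
Qed.

Lemma solution_lipschitz :
  exists P, 0 <= P /\ forall s t, 0 <= s -> s <= t -> t <= T ->
    Rabs (y t - y s) + Rabs (z t - z s) <= P * (t - s).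
Proof.
  destruct solution_bounded as [M [HM Hb]].
  set (P := Rabs (F1 0 0) + Rabs (F2 0 0) + 2 * (K * M)).
  assert (HKM : 0 <= K * M) by (apply Rmult_le_pos; assumption).
  exists P. split.
  { unfold P. generalize (Rabs_pos (F1 0 0)) (Rabs_pos (F2 0 0)). lra. }
  intros s t Hs Hst Ht. destruct sol as [Hy [Hz [Dy Dz]]].
  destruct (mean_value y _ T s t Hy Dy Hs Hst Ht) as [x1 [Hx1 ->]].
  destruct (mean_value z _ T s t Hz Dz Hs Hst Ht) as [x2 [Hx2 ->]].
  rewrite !Rabs_mult, (Rabs_pos_eq (t - s)) by lra.
  rewrite <- Rmult_plus_distr_r. apply Rmult_le_compat_r; [lra|].
  assert (B1 := lipschitz2_growth F1 (y x1) (z x1) F1_lip).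
  assert (B2 := lipschitz2_growth F2 (y x2) (z x2) F2_lip).
  assert (C1 := Rmult_le_compat_l K _ _ K_pos (Hb x1 ltac:(lra))).
  assert (C2 := Rmult_le_compat_l K _ _ K_pos (Hb x2 ltac:(lra))).
  unfold P. lra.
Qed.

(** The increment is [h] times the right-hand side at an intermediate point, by the mean value
    theorem. That point is within [P * h] of the start, so a Lipschitz right-hand side already gives
    an error of order [h ^ 2]. *)
Lemma solution_euler :
  exists C, 0 <= C /\ forall s h, 0 <= s -> 0 <= h -> s + h <= T ->
    Rabs (y (s + h) - y s - h * F1 (y s) (z s)) <= C * h ^ 2 /\
    Rabs (z (s + h) - z s - h * F2 (y s) (z s)) <= C * h ^ 2.
Proof.
  destruct solution_lipschitz as [P [HP Hlip]].
  assert (HKP : 0 <= K * P) by (apply Rmult_le_pos; assumption).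
  exists (K * P). split; [exact HKP|].
  intros s h Hs Hh Hsh. destruct sol as [Hy [Hz [Dy Dz]]].
  assert (Aux : forall F x, lipschitz2 K F -> s <= x <= s + h ->
    Rabs (F (y x) (z x) * (s + h - s) - h * F (y s) (z s)) <= K * P * h ^ 2).
  { intros F x HF Hx.
    replace (F (y x) (z x) * (s + h - s) - h * F (y s) (z s)) with
      (h * (F (y x) (z x) - F (y s) (z s))) by ring.
    rewrite Rabs_mult, (Rabs_pos_eq h Hh).
    replace (K * P * h ^ 2) with (h * (K * (P * h))) by ring.
    apply Rmult_le_compat_l; [exact Hh|].
    apply Rle_trans with (1 := HF _ _ _ _).
    apply Rmult_le_compat_l; [exact K_pos|].
    apply Rle_trans with (1 := Hlip s x Hs (proj1 Hx) ltac:(lra)).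
    apply Rmult_le_compat_l; lra. }
  destruct (mean_value y _ T s (s + h) Hy Dy Hs ltac:(lra) Hsh) as [x1 [Hx1 ->]].
  destruct (mean_value z _ T s (s + h) Hz Dz Hs ltac:(lra) Hsh) as [x2 [Hx2 ->]].
  split; apply Aux; assumption.
Qed.

(** Serves both orders of the limits: the limit scheme and the method for fixed e. The local error
    may grow with the numerical solution, which has no a priori bound. *)
Lemma first_order_convergence (A : R) :
  0 <= A ->
  exists C, 0 <= C /\ forall (dt : R) (N : nat) (u v : nat -> R),
    0 < dt -> INR N * dt <= T -> u 0%nat = y 0 -> v 0%nat = z 0 ->
    (forall n, (n < N)%nat ->
      Rabs (u (S n) - u n - dt * F1 (u n) (v n)) +
      Rabs (v (S n) - v n - dt * F2 (u n) (v n))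
        <= A * dt ^ 2 * (1 + Rabs (u n) + Rabs (v n))) ->
    forall n, (n <= N)%nat ->
      Rabs (u n - y (INR n * dt)) + Rabs (v n - z (INR n * dt)) <= C * dt.
Proof.
  intros HA.
  destruct solution_bounded as [M [HM Hb]].
  destruct solution_euler as [C0 [HC0 Heuler]].
  (* In the local error, the size of [u n] and [v n] is replaced by [M] plus the current error. The
     latter part, with [A * dt ^ 2 <= A * T * dt], joins the two Lipschitz terms in [a]; the rest
     and the two Euler remainders form [B]. The 1 keeps [a] positive. *)
  set (a := 2 * K + A * T + 1). set (B := A * (1 + M) + 2 * C0).
  assert (Ha : 0 < a).
  { unfold a. assert (0 <= A * T) by (apply Rmult_le_pos; lra). lra. }
  assert (HB : 0 <= B).
  { unfold B. assert (0 <= A * (1 + M)) by (apply Rmult_le_pos; lra). lra. }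
  exists (exp (a * T) * (B / a)). split.
  { apply Rmult_le_pos; [apply Rlt_le, exp_pos|].
    apply Rle_mult_inv_pos; assumption. }
  intros dt N u v Hdt HN Hu0 Hv0 Hstep.
  apply (discrete_gronwall
    (fun n => Rabs (u n - y (INR n * dt)) + Rabs (v n - z (INR n * dt))));
    try assumption.
  { simpl INR. rewrite Rmult_0_l, Hu0, Hv0.
    replace (y 0 - y 0) with 0 by ring. replace (z 0 - z 0) with 0 by ring.
    rewrite Rabs_R0. ring. }
  intros n Hn. specialize (Hstep n Hn).
  assert (HnN : INR n + 1 <= INR N) by (rewrite <- S_INR; apply le_INR; lia).
  assert (Hn0 := pos_INR n).
  set (s := INR n * dt) in *.
  assert (Hs : 0 <= s) by (apply Rmult_le_pos; lra).
  assert (Hsdt : s + dt <= T).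
  { apply Rle_trans with (2 := HN). unfold s. nra. }
  replace (INR (S n) * dt) with (s + dt) by (unfold s; rewrite S_INR; ring).
  destruct (Heuler s dt Hs (Rlt_le _ _ Hdt) Hsdt) as [E1 E2].
  specialize (Hb s ltac:(lra)).
  set (p := Rabs (u n - y s)). set (q := Rabs (v n - z s)).
  assert (L1 := F1_lip (u n) (v n) (y s) (z s)).
  assert (L2 := F2_lip (u n) (v n) (y s) (z s)). fold p q in L1, L2.
  assert (S1 : Rabs (u n) <= Rabs (y s) + p).
  { replace (u n) with (y s + (u n - y s)) by ring. apply Rabs_triang. }
  assert (S2 : Rabs (v n) <= Rabs (z s) + q).
  { replace (v n) with (z s + (v n - z s)) by ring. apply Rabs_triang. }
  assert (Aux : forall u' un y' ys f f' : R,
    Rabs (u' - y') <= Rabs (u' - un - dt * f) + Rabs (un - ys)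
      + dt * Rabs (f - f') + Rabs (y' - ys - dt * f')).
  { intros. replace (u' - y') with ((u' - un - dt * f) + (un - ys)
      + dt * (f - f') + - (y' - ys - dt * f')) by ring.
    assert (X : dt * Rabs (f - f') = Rabs (dt * (f - f')))
      by (rewrite Rabs_mult, (Rabs_pos_eq dt); lra).
    rewrite X, <- (Rabs_Ropp (y' - ys - dt * f')).
    eapply Rle_trans; [apply Rabs_triang|]. apply Rplus_le_compat_r.
    eapply Rle_trans; [apply Rabs_triang|]. apply Rplus_le_compat_r.
    apply Rabs_triang. }
  assert (T1 := Aux (u (S n)) (u n) (y (s + dt)) (y s)
    (F1 (u n) (v n)) (F1 (y s) (z s))).
  assert (T2 := Aux (v (S n)) (v n) (z (s + dt)) (z s)
    (F2 (u n) (v n)) (F2 (y s) (z s))). fold p in T1. fold q in T2.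
  apply (Rmult_le_compat_l dt) in L1; [|lra].
  apply (Rmult_le_compat_l dt) in L2; [|lra].
  assert (Hpq : 0 <= p + q) by (apply Rplus_le_le_0_compat; apply Rabs_pos).
  assert (HAd : A * dt ^ 2 * (1 + Rabs (u n) + Rabs (v n))
    <= A * dt ^ 2 * (1 + M) + A * T * dt * (p + q)).
  { apply Rle_trans with (A * dt ^ 2 * (1 + M + (p + q))).
    - apply Rmult_le_compat_l; [apply Rmult_le_pos; [lra|nra]|lra].
    - assert (A * dt ^ 2 * (p + q) <= A * T * dt * (p + q)); [|lra].
      apply Rmult_le_compat_r; [exact Hpq|].
      replace (A * T * dt) with (A * (T * dt)) by ring.
      apply Rmult_le_compat_l; [exact HA|]. nra. }
  apply Rle_trans with ((p + q) + dt * (K * (p + q)) + dt * (K * (p + q))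
    + (A * dt ^ 2 * (1 + M) + A * T * dt * (p + q)) + 2 * (C0 * dt ^ 2)); [lra|].
  assert (Hdp : 0 <= dt * (p + q)) by (apply Rmult_le_pos; lra).
  unfold a, B. lra.
Qed.

End System.

(** * Picard iteration *)

Lemma geometric_limit (u : nat -> R) (P : R) :
  (forall k, Rabs (u (S k) - u k) <= P * (1 / 2) ^ k) ->
  exists l, forall k, Rabs (u k - l) <= 2 * P * (1 / 2) ^ k.
Proof.
  intros Hu.
  assert (HP : 0 <= P).
  { generalize (Hu 0%nat) (Rabs_pos (u 1%nat - u 0%nat)). simpl. lra. }
  assert (Hpow : forall k, 0 < (1 / 2) ^ k) by (intros k; apply pow_lt; lra).
  (* Keeping the subtracted tail of the geometric series makes the induction on [m] close. *)
  assert (Hm : forall k m, Rabs (u (k + m)%nat - u k) <=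
    2 * P * (1 / 2) ^ k - 2 * P * (1 / 2) ^ (k + m)).
  { intros k m. induction m as [|m IH].
    - rewrite Nat.add_0_r. replace (u k - u k) with 0 by ring. rewrite Rabs_R0. lra.
    - rewrite Nat.add_succ_r. generalize (Hu (k + m)%nat).
      replace (u (S (k + m)) - u k) with
        ((u (S (k + m)) - u (k + m)%nat) + (u (k + m)%nat - u k)) by ring.
      generalize (Rabs_triang (u (S (k + m)) - u (k + m)%nat) (u (k + m)%nat - u k)).
      simpl pow. lra. }
  assert (Htail : is_lim_seq (fun k => 2 * P * (1 / 2) ^ k) 0).
  { apply lim_eq with (2 * P * 0); [ring|].
    apply lim_mult; [exact _|apply filterlim_const|].
    apply is_lim_seq_geom. rewrite Rabs_pos_eq; lra. }
  destruct (Rcomplete.R_complete u) as [l Hl].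
  { intros eps He.
    destruct (proj1 (lim_eps _ _ _) Htail (eps / 2) ltac:(lra)) as [N HN].
    assert (Half : forall n, (n >= N)%nat -> Rabs (u n - u N) < eps / 2).
    { intros n Hn. specialize (HN N (le_n _)). rewrite Rminus_0_r in HN.
      generalize (Hm N (n - N)%nat). replace (N + (n - N))%nat with n by lia.
      generalize (Rle_abs (2 * P * (1 / 2) ^ N)) (Hpow n) .
      intros H1 H2 H3. assert (0 <= 2 * P * (1 / 2) ^ n) by (apply Rmult_le_pos; lra).
      lra. }
    exists N. intros n m Hn Hm'. unfold Rdist.
    replace (u n - u m) with ((u n - u N) - (u m - u N)) by ring.
    apply Rle_lt_trans with (1 := Rabs_triang _ _). rewrite Rabs_Ropp.
    generalize (Half n Hn) (Half m Hm'). lra. }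
  exists l. intros k. apply le_epsilon. intros eps He.
  destruct (Hl eps He) as [N HN].
  specialize (HN (k + N)%nat ltac:(lia)). unfold Rdist in HN.
  generalize (Hm k N). assert (0 <= 2 * P * (1 / 2) ^ (k + N)).
  { apply Rmult_le_pos; [lra|apply Rlt_le, Hpow]. }
  replace (u k - l) with (- (u (k + N)%nat - u k) + (u (k + N)%nat - l)) by ring.
  generalize (Rabs_triang (- (u (k + N)%nat - u k)) (u (k + N)%nat - l)).
  rewrite Rabs_Ropp. lra.
Qed.

Lemma lipschitz2_continuous (K : R) (F : R -> R -> R) (a b : R) :
  0 < K -> lipschitz2 K F -> continuity_2d_pt F a b.
Proof.
  intros HK H eps.
  assert (Hd : 0 < eps / (2 * K)) by (apply Rdiv_lt_0_compat; [apply cond_pos|lra]).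
  exists (mkposreal _ Hd). simpl. intros u v Hu Hv.
  apply Rle_lt_trans with (1 := H _ _ _ _).
  replace (pos eps) with (K * (eps / (2 * K) + eps / (2 * K))) by (field; lra).
  apply Rmult_lt_compat_l; lra.
Qed.

Lemma lipschitz2_comp_continuous (K : R) (F : R -> R -> R) (u v : R -> R) (s : R) :
  0 < K -> lipschitz2 K F -> continuity_pt u s -> continuity_pt v s ->
  continuity_pt (fun t => F (u t) (v t)) s.
Proof.
  intros HK HF Hu Hv. apply continuity_pt_filterlim.
  apply continuity_pt_filterlim in Hu. apply continuity_pt_filterlim in Hv.
  apply lim_2d; try exact _; try assumption. exact (lipschitz2_continuous K F _ _ HK HF).
Qed.

Lemma continuous_is_RInt (f : R -> R) (a b : R) :
  (forall s, continuity_pt f s) -> is_RInt f a b (RInt f a b).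
Proof.
  intros Hf. apply (RInt_correct (V := R_CompleteNormedModule)).
  apply (ex_RInt_continuous (V := R_CompleteNormedModule)).
  intros s _. apply continuity_pt_filterlim, Hf.
Qed.

Lemma integral_derive (f : R -> R) (t : R) :
  (forall s, continuity_pt f s) -> is_derive (fun t => RInt f 0 t) t (f t).
Proof.
  intros Hf. apply (is_derive_RInt f (fun t => RInt f 0 t) 0 t).
  - apply filter_forall. intros s. apply continuous_is_RInt, Hf.
  - apply continuity_pt_filterlim, Hf.
Qed.

(** Integrating the weight [exp (a * s)] gains the factor [1 / a], which beats the Lipschitz
    constant when [a] is a large enough multiple of it. *)
Lemma integral_exp_bound (f h : R -> R) (a P t : R) :
  0 < a -> 0 <= P -> 0 <= t ->
  (forall s, continuity_pt f s) -> (forall s, continuity_pt h s) ->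
  (forall s, 0 <= s <= t -> Rabs (f s - h s) <= P * exp (a * s)) ->
  Rabs (RInt f 0 t - RInt h 0 t) <= P / a * exp (a * t).
Proof.
  intros Ha HP Ht Hf Hh Hle.
  assert (Hint := is_RInt_minus (V := R_NormedModule) _ _ _ _ _ _
    (continuous_is_RInt f 0 t Hf) (continuous_is_RInt h 0 t Hh)).
  assert (Hexp : is_RInt (fun s => P * exp (a * s)) 0 t
    (P / a * exp (a * t) - P / a * exp (a * 0))).
  { apply (is_RInt_derive (V := R_CompleteNormedModule) (fun s => P / a * exp (a * s))).
    - intros s _. auto_derive; [exact I|]. field. lra.
    - intros s _. apply continuity_pt_filterlim, derivable_continuous_pt,
        ex_derive_Reals_0. auto_derive. exact I. }
  assert (H := norm_RInt_le (V := R_NormedModule) _ _ 0 t _ _ Ht Hle Hint Hexp).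
  apply Rle_trans with (1 := H). rewrite Rmult_0_r, exp_0.
  assert (0 <= P / a) by (apply Rle_mult_inv_pos; lra). lra.
Qed.

Section Picard.

Context (F1 F2 : R -> R -> R) (K y0 z0 : R) (K_pos : 0 < K)
  (F1_lip : lipschitz2 K F1) (F2_lip : lipschitz2 K F2).

Fixpoint picard_iterate (k : nat) : (R -> R) * (R -> R) :=
  match k with
  | O => (fun _ => y0, fun _ => z0)
  | S k => let (u, v) := picard_iterate k in
      (fun t => y0 + RInt (fun s => F1 (u s) (v s)) 0 t,
       fun t => z0 + RInt (fun s => F2 (u s) (v s)) 0 t)
  end.

Lemma picard_iterate_continuous (k : nat) (s : R) :
  continuity_pt (fst (picard_iterate k)) s /\
  continuity_pt (snd (picard_iterate k)) s.
Proof.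
  revert s. induction k as [|k IH]; intros s.
  - split; apply continuity_pt_const; intros a b; reflexivity.
  - simpl. destruct (picard_iterate k) as [u v]. simpl in *.
    assert (Aux : forall F x, lipschitz2 K F ->
      continuity_pt (fun t => x + RInt (fun s => F (u s) (v s)) 0 t) s).
    { intros F x HF. apply continuity_pt_plus.
      - apply continuity_pt_const. intros a b. reflexivity.
      - apply derivable_continuous_pt, ex_derive_Reals_0.
        exists (F (u s) (v s)). apply (integral_derive (fun s => F (u s) (v s))).
        intros r. apply (lipschitz2_comp_continuous K); try assumption; apply IH. }
    split; apply Aux; assumption.
Qed.

(* With the weight exp (4 K t) the Picard map is a contraction of factor 1/2 on
   the whole half line. *)
Lemma picard_iterate_cauchy :
  exists M, 0 <= M /\ forall k t, 0 <= t ->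
    Rabs (fst (picard_iterate (S k)) t - fst (picard_iterate k) t)
      <= M * (1 / 2) ^ k * exp (4 * K * t) /\
    Rabs (snd (picard_iterate (S k)) t - snd (picard_iterate k) t)
      <= M * (1 / 2) ^ k * exp (4 * K * t).
Proof.
  set (M := (Rabs (F1 y0 z0) + Rabs (F2 y0 z0)) / (4 * K)).
  assert (Hs : 0 <= Rabs (F1 y0 z0) + Rabs (F2 y0 z0)).
  { generalize (Rabs_pos (F1 y0 z0)) (Rabs_pos (F2 y0 z0)). lra. }
  assert (HM : 0 <= M) by (apply Rle_mult_inv_pos; lra).
  exists M. split; [exact HM|]. induction k as [|k IH]; intros t Ht.
  - assert (Aux : forall x f, Rabs f <= Rabs (F1 y0 z0) + Rabs (F2 y0 z0) ->
      Rabs (x + RInt (fun _ => f) 0 t - x) <= M * (1 / 2) ^ 0 * exp (4 * K * t)).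
    { intros x f Hf.
      rewrite (RInt_const (V := R_CompleteNormedModule)).
      change (scal (t - 0) f) with ((t - 0) * f).
      replace (x + (t - 0) * f - x) with (t * f) by ring.
      rewrite Rabs_mult, (Rabs_pos_eq t Ht).
      apply Rle_trans with (t * (Rabs (F1 y0 z0) + Rabs (F2 y0 z0)));
        [apply Rmult_le_compat_l; assumption|].
      replace (t * (Rabs (F1 y0 z0) + Rabs (F2 y0 z0))) with (M * (4 * K * t))
        by (unfold M; field; lra).
      simpl pow. rewrite Rmult_1_r. apply Rmult_le_compat_l; [exact HM|].
      assert (0 <= 4 * K * t) by (apply Rmult_le_pos; lra).
      destruct (Req_dec (4 * K * t) 0) as [E|E];
        [rewrite E, exp_0; lra|apply Rlt_le].
      apply Rlt_trans with (1 + 4 * K * t); [lra|apply exp_ineq1, E]. }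
    simpl picard_iterate. split; apply Aux;
      generalize (Rabs_pos (F1 y0 z0)) (Rabs_pos (F2 y0 z0)); lra.
  - assert (Hc := picard_iterate_continuous k).
    assert (Hc' := picard_iterate_continuous (S k)).
    set (p' := picard_iterate (S k)) in *.
    change (picard_iterate (S (S k))) with (let (u, v) := p' in
      (fun t => y0 + RInt (fun s => F1 (u s) (v s)) 0 t,
       fun t => z0 + RInt (fun s => F2 (u s) (v s)) 0 t)).
    replace (fst p' t) with (y0 + RInt (fun s => F1 (fst (picard_iterate k) s)
      (snd (picard_iterate k) s)) 0 t)
      by (unfold p'; simpl; destruct (picard_iterate k); reflexivity).
    replace (snd p' t) with (z0 + RInt (fun s => F2 (fst (picard_iterate k) s)
      (snd (picard_iterate k) s)) 0 t)
      by (unfold p'; simpl; destruct (picard_iterate k); reflexivity).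
    clearbody p'. destruct p' as [u' v']. destruct (picard_iterate k) as [u v].
    simpl fst in *. simpl snd in *.
    assert (Aux : forall F x, lipschitz2 K F ->
      Rabs (x + RInt (fun s => F (u' s) (v' s)) 0 t
            - (x + RInt (fun s => F (u s) (v s)) 0 t))
        <= M * (1 / 2) ^ S k * exp (4 * K * t)).
    { intros F x HF.
      replace (x + RInt (fun s => F (u' s) (v' s)) 0 t
            - (x + RInt (fun s => F (u s) (v s)) 0 t)) with
        (RInt (fun s => F (u' s) (v' s)) 0 t - RInt (fun s => F (u s) (v s)) 0 t)
        by ring.
      assert (Hp : 0 < (1 / 2) ^ k) by (apply pow_lt; lra).
      (* Lipschitz constant [K], two components, and [1 / (4 * K)] from the integral: together the
         factor 1/2. *)
      apply Rle_trans with
        (K * (2 * (M * (1 / 2) ^ k)) / (4 * K) * exp (4 * K * t)).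
      - apply integral_exp_bound; try assumption; try lra.
        + apply Rmult_le_pos; [lra|]. apply Rmult_le_pos; [lra|].
          apply Rmult_le_pos; lra.
        + intros s. apply (lipschitz2_comp_continuous K); try assumption; apply Hc'.
        + intros s. apply (lipschitz2_comp_continuous K); try assumption; apply Hc.
        + intros s Hs'. apply Rle_trans with (1 := HF _ _ _ _).
          rewrite Rmult_assoc. apply Rmult_le_compat_l; [lra|].
          generalize (IH s (proj1 Hs')). lra.
      - right. simpl pow. field. lra. }
    split; apply Aux; assumption.
Qed.

Lemma picard : exists y z : R -> R, y 0 = y0 /\ z 0 = z0 /\
  forall T, solves F1 F2 T y z.
Proof.
  destruct picard_iterate_cauchy as [M [HM Hcauchy]].
  assert (Hlim : forall p : (R -> R) * (R -> R) -> R -> R,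
    (forall k t, 0 <= t -> Rabs (p (picard_iterate (S k)) t - p (picard_iterate k) t)
      <= M * (1 / 2) ^ k * exp (4 * K * t)) ->
    (forall k s, continuity_pt (p (picard_iterate k)) s) ->
    exists w : R -> R, (forall s, continuity_pt w s) /\
      forall k t, 0 <= t ->
        Rabs (p (picard_iterate k) t - w t) <= 2 * M * (1 / 2) ^ k * exp (4 * K * t)).
  { intros p Hp Hcont.
    (* The estimates hold for [t >= 0] only; evaluating at [Rmax 0 t] extends the limit by a
       constant to negative times and makes it continuous on the whole line. *)
    destruct (functional_choice (fun t l => forall k,
      Rabs (p (picard_iterate k) (Rmax 0 t) - l)
        <= 2 * (M * exp (4 * K * Rmax 0 t)) * (1 / 2) ^ k)) as [w Hw].
    { intros t. apply (geometric_limit (fun k => p (picard_iterate k) (Rmax 0 t))).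
      intros k. generalize (Hp k (Rmax 0 t) (Rmax_l _ _)). lra. }
    exists w. split.
    - intros s.
      apply (CVU_continuity (fun k t => p (picard_iterate k) (Rmax 0 t)) w s
        (mkposreal 1 Rlt_0_1)).
      + intros eps He. simpl pos.
        (* On the unit ball around [s] the weight is at most its value at [Rmax 0 (s + 1)], so the
           convergence is uniform there. *)
        set (P := 2 * (M * exp (4 * K * Rmax 0 (s + 1)))).
        assert (HP : is_lim_seq (fun k => P * (1 / 2) ^ k) 0).
        { apply lim_eq with (P * 0); [ring|].
          apply lim_mult; [exact _|apply filterlim_const|].
          apply is_lim_seq_geom. rewrite Rabs_pos_eq; lra. }
        destruct (proj1 (lim_eps _ _ _) HP eps He) as [N HN].
        exists N. intros n t Hn Ht. rewrite Rabs_minus_sym.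
        specialize (HN n Hn). rewrite Rminus_0_r in HN.
        apply Rle_lt_trans with (1 := Hw t n).
        apply Rle_lt_trans with (2 := HN).
        apply Rle_trans with (2 := Rle_abs _).
        apply Rmult_le_compat_r; [apply pow_le; lra|].
        apply Rmult_le_compat_l; [lra|]. apply Rmult_le_compat_l; [exact HM|].
        unfold Boule in Ht. simpl in Ht.
        assert (Hts : Rmax 0 t <= Rmax 0 (s + 1)).
        { apply Rle_max_compat_l. generalize (Rle_abs (t - s)). lra. }
        assert (Hm : 4 * K * Rmax 0 t <= 4 * K * Rmax 0 (s + 1))
          by (apply Rmult_le_compat_l; lra).
        destruct Hm as [Hm|Hm]; [apply Rlt_le, exp_increasing, Hm|rewrite Hm; lra].
      + intros n t _. apply (continuity_pt_comp (Rmax 0) (p (picard_iterate n)));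
          [|apply Hcont].
        apply continuity_pt_filterlim. apply lim_eps; [exact _|].
        intros eps He. exists (mkposreal eps He). intros r Hr.
        change (Rabs (r - t) < eps) in Hr. apply Rle_lt_trans with (2 := Hr).
        unfold Rmax. destruct (Rle_dec 0 r), (Rle_dec 0 t); unfold Rabs;
          repeat destruct Rcase_abs; lra.
      + unfold Boule. simpl. replace (s - s) with 0 by ring. rewrite Rabs_R0. lra.
    - intros k t Ht. generalize (Hw t k). rewrite Rmax_right by exact Ht. lra. }
  destruct (Hlim fst) as [y [Hyc Hy]].
  { intros k t Ht. apply Hcauchy, Ht. }
  { intros k s. apply picard_iterate_continuous. }
  destruct (Hlim snd) as [z [Hzc Hz]].
  { intros k t Ht. apply Hcauchy, Ht. }
  { intros k s. apply picard_iterate_continuous. }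
  assert (Hint : forall F x w t, lipschitz2 K F -> 0 <= t ->
    (forall k, Rabs (x + RInt (fun s => F (fst (picard_iterate k) s)
       (snd (picard_iterate k) s)) 0 t - w) <= 2 * M * (1 / 2) ^ (S k) * exp (4 * K * t)) ->
    w = x + RInt (fun s => F (y s) (z s)) 0 t).
  { intros F x w t HF Ht Hw.
    set (I := x + RInt (fun s => F (y s) (z s)) 0 t).
    assert (Hk : forall k, Rabs (w - I) <= 2 * M * exp (4 * K * t) * (1 / 2) ^ k).
    { intros k. specialize (Hw k).
      set (J := x + RInt (fun s => F (fst (picard_iterate k) s)
        (snd (picard_iterate k) s)) 0 t) in Hw.
      assert (HJ : Rabs (J - I) <= M * (1 / 2) ^ k * exp (4 * K * t)).
      { replace (J - I) with (RInt (fun s => F (fst (picard_iterate k) s)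
          (snd (picard_iterate k) s)) 0 t - RInt (fun s => F (y s) (z s)) 0 t)
          by (unfold I, J; ring).
        assert (Hp : 0 < (1 / 2) ^ k) by (apply pow_lt; lra).
        (* The 4 comes from two components, each within [2 * M * (1 / 2) ^ k] of its limit up to the
           weight. *)
        apply Rle_trans with
          (K * (4 * (M * (1 / 2) ^ k)) / (4 * K) * exp (4 * K * t));
          [|right; field; lra].
        apply integral_exp_bound; try assumption; try lra.
        + apply Rmult_le_pos; [lra|]. apply Rmult_le_pos; [lra|].
          apply Rmult_le_pos; lra.
        + intros s. apply (lipschitz2_comp_continuous K); try assumption;
            apply picard_iterate_continuous.
        + intros s. apply (lipschitz2_comp_continuous K);
            [exact K_pos|exact HF|apply Hyc|apply Hzc].
        + intros s Hs. apply Rle_trans with (1 := HF _ _ _ _).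
          rewrite Rmult_assoc. apply Rmult_le_compat_l; [lra|].
          generalize (Hy k s (proj1 Hs)) (Hz k s (proj1 Hs)). lra. }
      replace (w - I) with ((J - I) - (J - w)) by ring.
      apply Rle_trans with (1 := Rabs_triang _ _). rewrite Rabs_Ropp.
      simpl pow in Hw. lra. }
    apply Rminus_diag_uniq.
    assert (Hl : is_lim_seq (fun _ : nat => w - I) 0).
    { apply lim_squeeze with (fun k => 2 * M * exp (4 * K * t) * (1 / 2) ^ k);
        [exact _| |].
      - apply filter_forall. intros k. rewrite Rminus_0_r. apply Hk.
      - apply lim_eq with (2 * M * exp (4 * K * t) * 0); [ring|].
        apply lim_mult; [exact _|apply filterlim_const|].
        apply is_lim_seq_geom. rewrite Rabs_pos_eq; lra. }
    apply is_lim_seq_unique in Hl. rewrite Lim_seq_const in Hl.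
    injection Hl. tauto. }
  assert (Hyint : forall t, 0 <= t -> y t = y0 + RInt (fun s => F1 (y s) (z s)) 0 t).
  { intros t Ht. apply (Hint F1); [exact F1_lip|exact Ht|].
    intros k. generalize (Hy (S k) t Ht). simpl picard_iterate.
    destruct (picard_iterate k). tauto. }
  assert (Hzint : forall t, 0 <= t -> z t = z0 + RInt (fun s => F2 (y s) (z s)) 0 t).
  { intros t Ht. apply (Hint F2); [exact F2_lip|exact Ht|].
    intros k. generalize (Hz (S k) t Ht). simpl picard_iterate.
    destruct (picard_iterate k). tauto. }
  assert (Hder : forall F x w t, lipschitz2 K F -> 0 < t ->
    (forall s, 0 <= s -> w s = x + RInt (fun r => F (y r) (z r)) 0 s) ->
    is_derive w t (F (y t) (z t))).
  { intros F x w t HF Ht Hw.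
    apply is_derive_ext_loc with (fun s => x + RInt (fun r => F (y r) (z r)) 0 s).
    - exists (mkposreal t Ht). intros s Hs. symmetry. apply Hw.
      change (Rabs (s - t) < t) in Hs. generalize (Rabs_def2 _ _ Hs). lra.
    - assert (Hc : forall s, continuity_pt (fun r => F (y r) (z r)) s).
      { intros s. apply (lipschitz2_comp_continuous K);
          [exact K_pos|exact HF|apply Hyc|apply Hzc]. }
      assert (H := is_derive_plus (V := R_NormedModule) _ _ _ _ _
        (is_derive_const x t) (integral_derive _ t Hc)).
      rewrite plus_zero_l in H. exact H. }
  exists y, z. split; [|split].
  - rewrite (Hyint 0 (Rle_refl _)). rewrite RInt_point.
    change (y0 + 0 = y0). ring.
  - rewrite (Hzint 0 (Rle_refl _)). rewrite RInt_point.
    change (z0 + 0 = z0). ring.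
  - intros T. split; [intros; apply Hyc|]. split; [intros; apply Hzc|]. split.
    + intros s Hs. apply (Hder F1 y0); [exact F1_lip|apply Hs|exact Hyint].
    + intros s Hs. apply (Hder F2 z0); [exact F2_lip|apply Hs|exact Hzint].
Qed.

End Picard.

(** * Local error for fixed e *)

Lemma square_small (dt : R) : 0 < dt -> dt <= 1 -> 0 < dt ^ 2 <= dt.
Proof. intros H H1. split; [apply pow_lt, H|nra]. Qed.

Definition force (g : R -> R -> R) (e y z : R) : R := 1 / e * g y z.

(** The second derivative of z along the flow, as [force] is the first; with these two the method no
    longer shows e explicitly. *)
Definition force_rate (g : R -> R -> R) (e y z : R) : R := 1 / e * gdot g e y z.

Section Local_error.

Context (g : R -> R -> R) (e A : R) (e_pos : 0 < e) (A_pos : 0 < A).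

Local Notation f := (force g e).
Local Notation h := (force_rate g e).

Context (f_lip : lipschitz2 A f) (h_lip : lipschitz2 A h)
  (f_growth : forall y z, Rabs (f y z) <= A * (1 + Rabs y + Rabs z))
  (h_growth : forall y z, Rabs (h y z) <= A * (1 + Rabs y + Rabs z)).

(** The implicit terms enter only as differences to the start of the step and are at most
    [3 / 2 * dt * (A * D)]. The bound [4 * A * dt <= 1] lets them be absorbed into [D], which shows
    [D = O(dt)]; inserting this once more gives the second order in [dt]. *)
Lemma implicit_stage_error (dt P Q y z y' z' rho : R) :
  0 < dt -> dt <= 1 -> 4 * A * dt <= 1 ->
  let W := 1 + Rabs y + Rabs z in
  Rabs (y' - y) <= P * dt * W -> Rabs rho <= Q * dt ^ 2 * W ->
  z' - z - dt * f y z =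
    dt * (f y' z' - f y z) - dt ^ 2 / 2 * (h y' z' - h y z) + rho ->
  Rabs (z' - z - dt * f y z) <= (3 * A * (P + A + Q) + Q) * dt ^ 2 * W.
Proof.
  intros Hdt Hdt1 HAdt W Hy Hrho E.
  destruct (square_small dt Hdt Hdt1) as [Hsq Hsq1].
  set (D := Rabs (y' - y) + Rabs (z' - z)).
  assert (HD : 0 <= D) by (apply Rplus_le_le_0_compat; apply Rabs_pos).
  assert (Hf := f_lip y' z' y z). assert (Hh := h_lip y' z' y z).
  fold D in Hf, Hh.
  assert (HW : 1 <= W).
  { unfold W. generalize (Rabs_pos y) (Rabs_pos z). lra. }
  assert (HAD : 0 <= A * D) by (apply Rmult_le_pos; lra).
  assert (HQW : 0 <= Q * dt ^ 2 * W) by (generalize (Rabs_pos rho); lra).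
  assert (Hr : Rabs (z' - z - dt * f y z) <= 3 / 2 * dt * (A * D) + Q * dt ^ 2 * W).
  { rewrite E.
    assert (T1 : Rabs (dt * (f y' z' - f y z)) <= dt * (A * D)).
    { rewrite Rabs_mult, (Rabs_pos_eq dt) by lra. apply Rmult_le_compat_l; lra. }
    assert (T2 : Rabs (dt ^ 2 / 2 * (h y' z' - h y z)) <= 1 / 2 * dt * (A * D)).
    { rewrite Rabs_mult, (Rabs_pos_eq (dt ^ 2 / 2)) by lra.
      apply Rmult_le_compat; [lra|apply Rabs_pos|lra|exact Hh]. }
    revert T1 T2. generalize (dt * (f y' z' - f y z)).
    generalize (dt ^ 2 / 2 * (h y' z' - h y z)). intros b a T1 T2.
    generalize (Rabs_triang (a - b) rho) (Rabs_triang a (- b)).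
    rewrite Rabs_Ropp. fold (a - b). lra. }
  assert (Hz : Rabs (z' - z) <= dt * (A * W) + Rabs (z' - z - dt * f y z)).
  { replace (z' - z) with (dt * f y z + (z' - z - dt * f y z)) at 1 by ring.
    apply Rle_trans with (1 := Rabs_triang _ _). apply Rplus_le_compat_r.
    rewrite Rabs_mult, (Rabs_pos_eq dt) by lra.
    apply Rmult_le_compat_l; [lra|apply f_growth]. }
  assert (HDh : 3 / 2 * dt * (A * D) <= 1 / 2 * D).
  { replace (3 / 2 * dt * (A * D)) with (3 / 8 * (4 * A * dt) * D) by field. nra. }
  assert (HQ : Q * dt ^ 2 * W <= Q * dt * W).
  { assert (0 <= Q).
    { apply Rnot_lt_le. intros C. assert (0 < dt ^ 2 * W) by
        (apply Rmult_lt_0_compat; lra). nra. }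
    apply Rmult_le_compat_r; [lra|]. apply Rmult_le_compat_l; assumption. }
  assert (HD2 : D <= 2 * ((P + A + Q) * dt * W)).
  { assert (D <= P * dt * W + (dt * (A * W) + (1 / 2 * D + Q * dt * W)));
      [unfold D at 1; lra|lra]. }
  apply Rle_trans with (1 := Hr).
  apply Rle_trans with
    (3 / 2 * dt * (A * (2 * ((P + A + Q) * dt * W))) + Q * dt ^ 2 * W).
  - apply Rplus_le_compat_r, Rmult_le_compat_l; [lra|].
    apply Rmult_le_compat_l; lra.
  - right. field.
Qed.

Lemma stage_error (k : nat) :
  exists C, 0 <= C /\ forall (dt y z : R) (ys zs : nat -> R),
    0 < dt -> dt <= 1 -> 4 * A * dt <= 1 ->
    predictor g e dt y z (ys 0%nat) (zs 0%nat) ->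
    (forall j, (j < k)%nat ->
       corrector g e dt y z (ys j) (zs j) (ys (S j)) (zs (S j))) ->
    Rabs (ys k - y - dt * z) <= C * dt ^ 2 * (1 + Rabs y + Rabs z) /\
    Rabs (zs k - z - dt * f y z) <= C * dt ^ 2 * (1 + Rabs y + Rabs z).
Proof.
  induction k as [|k [C [HC IH]]].
  - exists (3 * A * (1 + A + A + A) + 2 * A).
    assert (HAA : 0 < A * A) by (apply Rmult_lt_0_compat; lra).
    split; [nra|].
    intros dt y z ys zs Hdt Hdt1 HAdt [Ey Ez] _.
    destruct (square_small dt Hdt Hdt1) as [Hsq Hsq1].
    generalize dependent (zs 0%nat). generalize dependent (ys 0%nat).
    intros y' Ey z' Ez.
    set (W := 1 + Rabs y + Rabs z).
    assert (HW : 1 <= W /\ Rabs z <= W).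
    { unfold W. generalize (Rabs_pos y) (Rabs_pos z). lra. }
    assert (Hd2 : 0 <= dt ^ 2 * W) by (apply Rmult_le_pos; lra).
    assert (Hy : Rabs (y' - y - dt * z) <= A * dt ^ 2 * W).
    { rewrite Ey. replace (y + dt * z + dt ^ 2 / (2 * e) * g y z - y - dt * z) with
        (dt ^ 2 / 2 * f y z) by (unfold force; field; lra).
      rewrite Rabs_mult, (Rabs_pos_eq (dt ^ 2 / 2)) by lra.
      apply Rle_trans with (dt ^ 2 * (A * W)); [|right; ring].
      apply Rmult_le_compat; [lra|apply Rabs_pos|lra|apply f_growth]. }
    split.
    + apply Rle_trans with (1 := Hy). rewrite !Rmult_assoc.
      apply Rmult_le_compat_r; [exact Hd2|nra].
    + apply Rle_trans with ((3 * A * (1 + A + A + A) + A) * dt ^ 2 * W).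
      * apply (implicit_stage_error dt (1 + A) A y z y' z'
          (- (dt ^ 2 / 2 * h y z))); try assumption.
        -- fold W. replace (y' - y) with (dt * z + (y' - y - dt * z)) by ring.
           apply Rle_trans with (1 := Rabs_triang _ _).
           rewrite Rabs_mult, (Rabs_pos_eq dt) by lra.
           assert (dt * Rabs z <= dt * W) by (apply Rmult_le_compat_l; lra).
           assert (A * dt ^ 2 * W <= A * dt * W); [|lra].
           apply Rmult_le_compat_r; [lra|]. apply Rmult_le_compat_l; lra.
        -- fold W. rewrite Rabs_Ropp, Rabs_mult, (Rabs_pos_eq (dt ^ 2 / 2)) by lra.
           apply Rle_trans with (dt ^ 2 * (A * W)); [|right; ring].
           apply Rmult_le_compat; [lra|apply Rabs_pos|lra|apply h_growth].
        -- rewrite Ez at 1. unfold force, force_rate. field. lra.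
      * rewrite !Rmult_assoc. apply Rmult_le_compat_r; [exact Hd2|lra].
  - set (M := 1 + A + 2 * C).
    assert (HAM : 0 <= A * M) by (apply Rmult_le_pos; unfold M; lra).
    assert (HM : 1 <= M) by (unfold M; lra).
    set (C' := 3 * A * (1 + (M + A * M) + A + 2 * (A * M)) + 2 * (A * M)).
    assert (HC' : 0 <= C').
    { unfold C'. assert (0 <= A * (1 + (M + A * M) + A + 2 * (A * M))); [|lra].
      apply Rmult_le_pos; lra. }
    exists (M + A * M + C'). split; [lra|].
    intros dt y z ys zs Hdt Hdt1 HAdt Hp Hc.
    destruct (square_small dt Hdt Hdt1) as [Hsq Hsq1].
    destruct (IH dt y z ys zs Hdt Hdt1 HAdt Hp) as [Hyk Hzk];
      [intros j Hj; apply Hc; lia|].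
    destruct (Hc k (Nat.lt_succ_diag_r k)) as [Ey Ez]. clear IH Hp Hc.
    set (yk := ys k) in *. set (zk := zs k) in *.
    set (y' := ys (S k)) in *. set (z' := zs (S k)) in *.
    set (W := 1 + Rabs y + Rabs z) in *.
    assert (HW : 1 <= W /\ Rabs z <= W).
    { unfold W. generalize (Rabs_pos y) (Rabs_pos z). lra. }
    assert (Hd2 : 0 <= dt ^ 2 * W) by (apply Rmult_le_pos; lra).
    assert (Hd1 : dt ^ 2 * W <= dt * W) by (apply Rmult_le_compat_r; lra).
    set (D := Rabs (yk - y) + Rabs (zk - z)).
    assert (HD : D <= M * (dt * W)).
    { assert (D1 : Rabs (yk - y) <= dt * W + C * (dt * W)).
      { replace (yk - y) with (dt * z + (yk - y - dt * z)) by ring.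
        apply Rle_trans with (1 := Rabs_triang _ _).
        rewrite Rabs_mult, (Rabs_pos_eq dt) by lra. apply Rplus_le_compat.
        - apply Rmult_le_compat_l; lra.
        - apply Rle_trans with (1 := Hyk). rewrite Rmult_assoc.
          apply Rmult_le_compat_l; assumption. }
      assert (D2 : Rabs (zk - z) <= A * (dt * W) + C * (dt * W)).
      { replace (zk - z) with (dt * f y z + (zk - z - dt * f y z)) by ring.
        apply Rle_trans with (1 := Rabs_triang _ _).
        rewrite Rabs_mult, (Rabs_pos_eq dt) by lra. apply Rplus_le_compat.
        - apply Rle_trans with (dt * (A * W)); [|right; ring].
          apply Rmult_le_compat_l; [lra|apply f_growth].
        - apply Rle_trans with (1 := Hzk). rewrite Rmult_assoc.
          apply Rmult_le_compat_l; assumption. }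
      unfold D, M. lra. }
    assert (HAD : A * D <= A * M * (dt * W)).
    { rewrite Rmult_assoc. apply Rmult_le_compat_l; lra. }
    assert (Hfk := f_lip yk zk y z). assert (Hhk := h_lip yk zk y z).
    fold D in Hfk, Hhk.
    assert (Hfk' : forall r, 0 <= r -> r <= dt ->
      Rabs (r * (f yk zk - f y z)) <= A * M * (dt ^ 2 * W)).
    { intros r H0 H1. rewrite Rabs_mult, (Rabs_pos_eq r H0).
      apply Rle_trans with (dt * (A * M * (dt * W))); [|right; ring].
      apply Rmult_le_compat; [exact H0|apply Rabs_pos|exact H1|lra]. }
    assert (Hhk' : forall r, 0 <= r -> r <= dt ->
      Rabs (r * (h yk zk - h y z)) <= A * M * (dt ^ 2 * W)).
    { intros r H0 H1. rewrite Rabs_mult, (Rabs_pos_eq r H0).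
      apply Rle_trans with (dt * (A * M * (dt * W))); [|right; ring].
      apply Rmult_le_compat; [exact H0|apply Rabs_pos|exact H1|lra]. }
    assert (Hy : Rabs (y' - y - dt * z) <= (M + A * M) * (dt ^ 2 * W)).
    { replace (y' - y - dt * z) with
        (dt / 2 * (zk - z) + - (dt ^ 2 / 12 * (f yk zk - f y z)))
        by (rewrite Ey; unfold force; field; lra).
      apply Rle_trans with (1 := Rabs_triang _ _). rewrite Rabs_Ropp.
      assert (T1 : Rabs (dt / 2 * (zk - z)) <= M * (dt ^ 2 * W)).
      { rewrite Rabs_mult, (Rabs_pos_eq (dt / 2)) by lra.
        apply Rle_trans with (dt * (M * (dt * W))); [|right; ring].
        apply Rmult_le_compat; [lra|apply Rabs_pos|lra|].
        apply Rle_trans with (2 := HD). unfold D.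
        generalize (Rabs_pos (yk - y)). lra. }
      generalize (Hfk' (dt ^ 2 / 12) ltac:(lra) ltac:(lra)). lra. }
    split.
    + apply Rle_trans with (1 := Hy). rewrite (Rmult_assoc _ (dt ^ 2)).
      apply Rmult_le_compat_r; lra.
    + apply Rle_trans with (C' * dt ^ 2 * W);
        [|rewrite !(Rmult_assoc _ (dt ^ 2)); apply Rmult_le_compat_r; lra].
      apply Rle_trans with ((3 * A * ((1 + (M + A * M)) + A + 2 * (A * M))
        + 2 * (A * M)) * dt ^ 2 * W); [|right; unfold C'; ring].
      (* Regrouping around the start of the step leaves [- dt / 2] times the difference of [f] at
         the previous stage, and the factor 1/2 - 1/12 = 5/12 for that of [h]. *)
      apply (implicit_stage_error dt _ _ y z y' z'
        (- (dt / 2 * (f yk zk - f y z)) + 5 / 12 * dt ^ 2 * (h yk zk - h y z)));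
        try assumption; fold W.
      * replace (y' - y) with (dt * z + (y' - y - dt * z)) by ring.
        apply Rle_trans with (1 := Rabs_triang _ _).
        rewrite Rabs_mult, (Rabs_pos_eq dt) by lra.
        assert (dt * Rabs z <= dt * W) by (apply Rmult_le_compat_l; lra).
        assert ((M + A * M) * (dt ^ 2 * W) <= (M + A * M) * (dt * W)); [|lra].
        apply Rmult_le_compat_l; lra.
      * apply Rle_trans with (1 := Rabs_triang _ _). rewrite Rabs_Ropp.
        generalize (Hfk' (dt / 2) ltac:(lra) ltac:(lra))
          (Hhk' (5 / 12 * dt ^ 2) ltac:(lra) ltac:(lra)). lra.
      * rewrite Ez at 1. unfold force, force_rate. field. lra.
Qed.

Lemma one_step_error (kmax : nat) :
  exists C, 0 <= C /\ forall (dt y z y' z' : R),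
    0 < dt -> dt <= 1 -> 4 * A * dt <= 1 ->
    one_step g kmax e dt y z y' z' ->
    Rabs (y' - y - dt * z) + Rabs (z' - z - dt * f y z)
      <= C * dt ^ 2 * (1 + Rabs y + Rabs z).
Proof.
  destruct (stage_error kmax) as [C [HC H]].
  exists (2 * C). split; [lra|].
  intros dt y z y' z' Hdt Hdt1 HAdt [ys [zs [Hp [Hc [-> ->]]]]].
  destruct (H dt y z ys zs Hdt Hdt1 HAdt Hp Hc). lra.
Qed.

End Local_error.

(** * Singular perturbation of the exact solution *)

Section Singular_perturbation.

Context (g : R -> R -> R) (c L : R) (g_smooth : smooth g) (c_pos : 0 < c)
  (dz_neg : forall y z, dz g y z < - c)
  (g_lip : forall y1 z1 y2 z2,
    Rabs (g y1 z1 - g y2 z2) <= L * (Rabs (y1 - y2) + Rabs (z1 - z2)))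
  (zeta : R -> R) (zeta_zero : forall y, g y (zeta y) = 0)
  (T : R) (Y : R -> R) (T_pos : 0 < T)
  (Y_cont : forall s, 0 <= s <= T -> continuity_pt Y s)
  (Y_deriv : forall s, 0 < s < T -> is_derive Y s (zeta (Y s))).

(* The constraint defect g (y, z) decays at rate c / e along the flow, which
   makes (y - Y)^2 + (e / c) g (y, z)^2 a Lyapunov function. *)
Lemma singular_perturbation :
  exists e1 C, 0 < e1 /\ 0 <= C /\ forall (e : R) (y z : R -> R),
    0 < e < e1 -> solves (fun _ z => z) (force g e) T y z ->
    let V0 := (y 0 - Y 0) ^ 2 + e / c * g (y 0) (z 0) ^ 2 in
    forall t, 0 <= t <= T ->
      (y t - Y t) ^ 2 <= C * (V0 + e) /\
      (C * (V0 + e) <= 1 -> g (y t) (z t) ^ 2 <= g (y 0) (z 0) ^ 2 + C * e).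
Proof.
  assert (HL := lip_pos g L g_lip).
  set (l := L / c).
  assert (Hl : 0 <= l) by (apply Rle_mult_inv_pos; assumption).
  assert (Hlc : L = l * c) by (unfold l; field; lra).
  destruct (continuous_bounded (fun s => zeta (Y s)) T (Rlt_le _ _ T_pos)) as [M [HM Hzeta]].
  { intros s Hs. apply (continuity_pt_comp Y zeta); [exact (Y_cont s Hs)|].
    exact (zeta_continuous g c L g_smooth c_pos dz_neg g_lip zeta zeta_zero _). }
  set (k := / c). assert (Hk : 0 < k) by (apply Rinv_0_lt_compat; exact c_pos).
  assert (Hck : c * k = 1) by (unfold k; field; lra).
  (* [A] collects the coefficients of [D ^ 2] that remain after Young's inequality. The damping
     [- 2 * G ^ 2] pays once for the [G ^ 2] in [Y1] and once for [e * q * G ^ 2], where [q] gathers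
     the terms in [G ^ 2] that carry a factor e. *)
  set (A := k ^ 2 + 2 * l + l ^ 2 + 1).
  assert (HA : 0 < A) by (unfold A; nra).
  set (q := 2 * l ^ 2 + 2 * l * k).
  assert (Hq : 0 <= q).
  { unfold q. assert (0 <= l * k) by (apply Rmult_le_pos; lra). nra. }
  (* Below [e1] one has [e <= 1], [e * q <= 1] and [4 * l * e <= c]; the added 1s avoid division by
     zero when [q] or [l] vanishes. *)
  set (e1 := Rmin 1 (Rmin (/ (q + 1)) (c / (4 * (l + 1))))).
  set (C1 := exp (A * T) * (1 + M ^ 2 / A)).
  set (C2 := 2 * l ^ 2 * (M + l) ^ 2).
  assert (HMA : 0 <= M ^ 2 / A) by (apply Rle_mult_inv_pos; [apply pow2_ge_0|exact HA]).
  assert (HC1 : 0 <= C1) by (apply Rmult_le_pos; [apply Rlt_le, exp_pos|lra]).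
  assert (HC2 : 0 <= C2).
  { unfold C2. rewrite Rmult_assoc. apply Rmult_le_pos; [lra|].
    apply Rmult_le_pos; apply pow2_ge_0. }
  exists e1, (C1 + C2). split; [|split; [lra|]].
  { apply Rmin_pos; [lra|]. apply Rmin_pos.
    - apply Rinv_0_lt_compat; lra.
    - apply Rdiv_lt_0_compat; lra. }
  intros e y z [He He1] [Hyc [Hzc [Hyd Hzd]]] V0 t Ht.
  assert (Hsmall : e <= 1 /\ e * q <= 1 /\ 4 * l * e <= c).
  { assert (E1 := Rmin_l 1 (Rmin (/ (q + 1)) (c / (4 * (l + 1))))).
    assert (E2 := Rmin_r 1 (Rmin (/ (q + 1)) (c / (4 * (l + 1))))).
    assert (E3 := Rmin_l (/ (q + 1)) (c / (4 * (l + 1)))).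
    assert (E4 := Rmin_r (/ (q + 1)) (c / (4 * (l + 1)))).
    fold e1 in E1, E2. split; [lra|]. split.
    - assert (e * (q + 1) <= / (q + 1) * (q + 1)) by (apply Rmult_le_compat_r; lra).
      rewrite Rinv_l in H by lra. lra.
    - assert (e * (4 * (l + 1)) <= c / (4 * (l + 1)) * (4 * (l + 1)))
        by (apply Rmult_le_compat_r; lra).
      replace (c / (4 * (l + 1)) * (4 * (l + 1))) with c in H by (field; lra). lra. }
  destruct Hsmall as [Hs1 [Hs2 Hs3]].
  assert (HV0 : 0 <= V0).
  { unfold V0. apply Rplus_le_le_0_compat; [apply pow2_ge_0|].
    apply Rmult_le_pos; [apply Rle_mult_inv_pos; lra|apply pow2_ge_0]. }
  set (gam := fun s => g (y s) (z s)).
  set (gam' := fun s => grad_dot g (y s) (z s) (z s) (force g e (y s) (z s))).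
  assert (Hgc : forall s, 0 <= s <= T -> continuity_pt gam s).
  { intros s Hs. apply continuity_pt_filterlim. apply lim_2d; try exact _.
    - apply smooth_continuous, g_smooth.
    - apply continuity_pt_filterlim, Hyc, Hs.
    - apply continuity_pt_filterlim, Hzc, Hs. }
  assert (Hgd : forall s, 0 < s < T -> is_derive gam s (gam' s)).
  { intros s Hs. apply smooth_derive_along;
      [exact g_smooth|exact (Hyd s Hs)|exact (Hzd s Hs)]. }
  assert (Hdist : forall s, Rabs (z s - zeta (y s)) <= k * Rabs (gam s)).
  { intros s. generalize (zeta_distance g c g_smooth c_pos dz_neg zeta zeta_zero (y s) (z s)).
    unfold Rdiv. fold k (gam s). lra. }
  assert (Hlip : forall s, Rabs (zeta (y s) - zeta (Y s)) <= l * Rabs (y s - Y s)).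
  { intros s. exact (zeta_lipschitz g c L g_smooth c_pos dz_neg g_lip zeta zeta_zero _ _). }
  assert (Hzb : forall s, 0 <= s <= T ->
    Rabs (z s) <= M + k * Rabs (gam s) + l * Rabs (y s - Y s)).
  { intros s Hs. specialize (Hzeta s Hs). specialize (Hdist s). specialize (Hlip s).
    replace (z s) with (zeta (Y s) + (z s - zeta (y s)) + (zeta (y s) - zeta (Y s))) by ring.
    generalize (Rabs_triang (zeta (Y s) + (z s - zeta (y s))) (zeta (y s) - zeta (Y s)))
      (Rabs_triang (zeta (Y s)) (z s - zeta (y s))). lra. }
  assert (Hgg : forall s, gam s * gam' s <=
    L * Rabs (gam s) * Rabs (z s) - c / e * gam s ^ 2).
  { intros s. unfold gam', grad_dot, force. fold (gam s).
    assert (H1 := dy_bounded g L g_smooth g_lip (y s) (z s)).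
    assert (H2 := dz_neg (y s) (z s)).
    assert (T1 : gam s * (dy g (y s) (z s) * z s) <= L * Rabs (gam s) * Rabs (z s)).
    { apply Rle_trans with (1 := Rle_abs _). rewrite !Rabs_mult.
      replace (Rabs (gam s) * (Rabs (dy g (y s) (z s)) * Rabs (z s))) with
        (Rabs (dy g (y s) (z s)) * (Rabs (gam s) * Rabs (z s))) by ring.
      rewrite Rmult_assoc. apply Rmult_le_compat_r; [|exact H1].
      apply Rmult_le_pos; apply Rabs_pos. }
    assert (T2 : gam s * (dz g (y s) (z s) * (1 / e * gam s)) <= - (c / e * gam s ^ 2)).
    { replace (gam s * (dz g (y s) (z s) * (1 / e * gam s))) with
        (dz g (y s) (z s) * (gam s ^ 2 / e)) by (field; lra).
      replace (- (c / e * gam s ^ 2)) with (- c * (gam s ^ 2 / e)) by (field; lra).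
      apply Rmult_le_compat_r; [|lra]. apply Rle_mult_inv_pos; [apply pow2_ge_0|lra]. }
    lra. }
  assert (HV : forall s, 0 <= s <= T ->
    (y s - Y s) ^ 2 + e / c * gam s ^ 2 <= C1 * (V0 + e)).
  { intros s Hs.
    apply Rle_trans with ((V0 + e * M ^ 2 / A) * exp (A * s) - e * M ^ 2 / A).
    - apply (gronwall (fun s => (y s - Y s) ^ 2 + e / c * gam s ^ 2)
        (fun s => 2 * (y s - Y s) * (z s - zeta (Y s)) + 2 * e / c * (gam s * gam' s))
        T A (e * M ^ 2)); [lra| | | |exact Hs]; clear s Hs.
      + intros s Hs. apply continuity_pt_plus.
        * apply (continuity_pt_comp (fun s => y s - Y s) (fun x => x ^ 2)).
          -- apply continuity_pt_minus; [apply Hyc, Hs|apply Y_cont, Hs].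
          -- apply derivable_continuous_pt, derivable_pt_pow.
        * apply continuity_pt_mult.
          -- apply continuity_pt_const. intros a b. reflexivity.
          -- apply (continuity_pt_comp gam (fun x => x ^ 2)); [apply Hgc, Hs|].
             apply derivable_continuous_pt, derivable_pt_pow.
      + intros s Hs. assert (D1 := Hyd s Hs). assert (D2 := Y_deriv s Hs).
        assert (D3 := Hgd s Hs). clearbody gam gam'.
        auto_derive; [repeat split; eexists; eassumption|].
        replace (Derive (fun x : R => y x) s) with (z s)
          by (symmetry; apply is_derive_unique; exact D1).
        replace (Derive (fun x : R => Y x) s) with (zeta (Y s))
          by (symmetry; apply is_derive_unique; exact D2).
        replace (Derive (fun x : R => gam x) s) with (gam' s)
          by (symmetry; apply is_derive_unique; exact D3).
        field. lra.
      + intros s Hs. specialize (Hzb s Hs). specialize (Hgg s).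
        set (D := Rabs (y s - Y s)) in *. set (G := Rabs (gam s)) in *.
        assert (HD2 : (y s - Y s) ^ 2 = D ^ 2) by (symmetry; apply pow2_abs).
        assert (HG2 : gam s ^ 2 = G ^ 2) by (symmetry; apply pow2_abs).
        assert (HD : 0 <= D) by apply Rabs_pos.
        assert (HG : 0 <= G) by apply Rabs_pos.
        rewrite HG2 in Hgg. rewrite HD2, HG2.
        assert (T1 : 2 * (y s - Y s) * (z s - zeta (Y s)) <= 2 * D * (k * G + l * D)).
        { apply Rle_trans with (1 := Rle_abs _).
          rewrite !Rabs_mult, (Rabs_pos_eq 2) by lra. fold D.
          apply Rmult_le_compat_l; [lra|].
          replace (z s - zeta (Y s)) with
            ((z s - zeta (y s)) + (zeta (y s) - zeta (Y s))) by ring.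
          apply Rle_trans with (1 := Rabs_triang _ _).
          apply Rplus_le_compat; [apply Hdist|apply Hlip]. }
        assert (T2 : 2 * e / c * (gam s * gam' s) <=
          2 * e * l * G * (M + k * G + l * D) - 2 * G ^ 2).
        { apply Rle_trans with (2 * e / c * (L * G * Rabs (z s) - c / e * G ^ 2)).
          - apply Rmult_le_compat_l; [apply Rle_mult_inv_pos; lra|exact Hgg].
          - replace (2 * e / c * (L * G * Rabs (z s) - c / e * G ^ 2)) with
              (2 * e * l * G * Rabs (z s) - 2 * G ^ 2) by (unfold l; field; lra).
            apply Rplus_le_compat_r, Rmult_le_compat_l; [|exact Hzb].
            apply Rmult_le_pos; [|exact HG]. apply Rmult_le_pos; lra. }
        assert (Y1 : 2 * D * (k * G) <= k ^ 2 * D ^ 2 + G ^ 2).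
        { generalize (pow2_ge_0 (k * D - G)). nra. }
        assert (Y2 : 2 * e * l * G * M <= e * (l ^ 2 * G ^ 2) + e * M ^ 2).
        { generalize (Rmult_le_pos _ _ (Rlt_le _ _ He) (pow2_ge_0 (l * G - M))). nra. }
        assert (Y3 : 2 * e * l * G * (l * D) <= e * (l ^ 2 * G ^ 2) + l ^ 2 * D ^ 2).
        { assert (X1 := Rmult_le_pos _ _ (Rlt_le _ _ He) (pow2_ge_0 (l * G - l * D))).
          assert (X2 : e * (l ^ 2 * D ^ 2) <= 1 * (l ^ 2 * D ^ 2)).
          { apply Rmult_le_compat_r; [|exact Hs1].
            apply Rmult_le_pos; apply pow2_ge_0. }
          nra. }
        assert (Y4 : e * q * G ^ 2 <= 1 * G ^ 2).
        { apply Rmult_le_compat_r; [apply pow2_ge_0|exact Hs2]. }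
        assert (Y5 : 0 <= A * (e / c * G ^ 2)).
        { apply Rmult_le_pos; [lra|]. apply Rmult_le_pos; [|apply pow2_ge_0].
          apply Rle_mult_inv_pos; lra. }
        assert (Y6 := pow2_ge_0 D).
        replace (e * q * G ^ 2) with
          (2 * (e * (l ^ 2 * G ^ 2)) + 2 * e * l * G * (k * G)) in Y4 by (unfold q; ring).
        replace (A * (D ^ 2 + e / c * G ^ 2)) with
          (k ^ 2 * D ^ 2 + 2 * l * D ^ 2 + l ^ 2 * D ^ 2 + D ^ 2 + A * (e / c * G ^ 2))
          by (unfold A; ring).
        replace (2 * D * (k * G + l * D)) with (2 * D * (k * G) + 2 * l * D ^ 2)
          in T1 by ring.
        lra.
    - assert (He2 : exp (A * s) <= exp (A * T)).
      { assert (A * s <= A * T) as [E|E]; [apply Rmult_le_compat_l; lra| |].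
        - apply Rlt_le, exp_increasing, E.
        - rewrite E. lra. }
      assert (HeA : 0 <= e * M ^ 2 / A).
      { replace (e * M ^ 2 / A) with (e * (M ^ 2 / A)) by (unfold Rdiv; ring).
        apply Rmult_le_pos; lra. }
      apply Rle_trans with ((V0 + e * M ^ 2 / A) * exp (A * T)).
      + assert ((V0 + e * M ^ 2 / A) * exp (A * s) <= (V0 + e * M ^ 2 / A) * exp (A * T));
          [|lra]. apply Rmult_le_compat_l; lra.
      + unfold C1. replace (e * M ^ 2 / A) with (e * (M ^ 2 / A)) by (unfold Rdiv; ring).
        rewrite Rmult_comm, Rmult_assoc.
        apply Rmult_le_compat_l; [apply Rlt_le, exp_pos|].
        assert (0 <= M ^ 2 / A * V0) by (apply Rmult_le_pos; lra). lra. }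
  assert (HCe : C1 * (V0 + e) <= (C1 + C2) * (V0 + e)) by (apply Rmult_le_compat_r; lra).
  assert (HD : forall s, 0 <= s <= T -> (y s - Y s) ^ 2 <= (C1 + C2) * (V0 + e)).
  { intros s Hs. apply Rle_trans with (2 := HCe).
    apply Rle_trans with (2 := HV s Hs).
    assert (0 <= e / c * gam s ^ 2); [|lra].
    apply Rmult_le_pos; [apply Rle_mult_inv_pos; lra|apply pow2_ge_0]. }
  split; [exact (HD t Ht)|]. intros Hone.
  (* The Lyapunov bound controls only [e / c * g ^ 2]. For [g ^ 2] itself, [Hone] keeps y within 1
     of [Y], which bounds z in terms of the defect; the defect then obeys an inequality with rate
     [- (c / e)] and source [b = O(e)]. *)
  set (b := 2 * e / c * (L * (M + l)) ^ 2).
  assert (Hb : 0 <= b).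
  { unfold b. apply Rmult_le_pos; [apply Rle_mult_inv_pos; lra|apply pow2_ge_0]. }
  assert (Hce : 0 < c / e) by (apply Rdiv_lt_0_compat; lra).
  assert (HW : gam t ^ 2 <= (gam 0 ^ 2 + b / (- (c / e))) * exp (- (c / e) * t)
      - b / (- (c / e))).
  { apply (gronwall (fun s => gam s ^ 2) (fun s => 2 * (gam s * gam' s)) T);
      [lra| | | |exact Ht].
    - intros s Hs. apply (continuity_pt_comp gam (fun x => x ^ 2)); [apply Hgc, Hs|].
      apply derivable_continuous_pt, derivable_pt_pow.
    - intros s Hs. assert (D3 := Hgd s Hs). clearbody gam gam'.
      auto_derive; [repeat split; eexists; eassumption|].
      replace (Derive (fun x : R => gam x) s) with (gam' s)
        by (symmetry; apply is_derive_unique; exact D3). ring.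
    - intros s Hs. specialize (Hzb s Hs). specialize (Hgg s).
      assert (HD1 : Rabs (y s - Y s) <= 1).
      { specialize (HD s Hs). rewrite <- pow2_abs in HD.
        generalize (Rabs_pos (y s - Y s)). nra. }
      set (G := Rabs (gam s)) in *.
      assert (HG2 : gam s ^ 2 = G ^ 2) by (symmetry; apply pow2_abs).
      assert (HG : 0 <= G) by apply Rabs_pos.
      rewrite HG2 in *.
      assert (Hlz : L * G * Rabs (z s) <= L * G * (M + l) + l * G ^ 2).
      { apply Rle_trans with (L * G * (M + l + k * G)).
        - apply Rmult_le_compat_l; [apply Rmult_le_pos; assumption|].
          assert (l * Rabs (y s - Y s) <= l * 1) by (apply Rmult_le_compat_l; assumption).
          lra.
        - right. unfold l, k. field. lra. }
      (* 2 x y <= x^2 + y^2 with the weight c / (2 e) *)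
      assert (Hyoung : 2 * (L * G * (M + l)) <= c / e / 2 * G ^ 2 + b).
      { assert (X := pow2_ge_0 (G - 2 * e / c * (L * (M + l)))).
        apply (Rmult_le_compat_l (c / e / 2)) in X; [|lra].
        rewrite Rmult_0_r in X.
        replace (c / e / 2 * (G - 2 * e / c * (L * (M + l))) ^ 2) with
          (c / e / 2 * G ^ 2 - 2 * (L * G * (M + l)) + b) in X
          by (unfold b; field; lra). lra. }
      assert (Hll : 2 * l * G ^ 2 <= c / e / 2 * G ^ 2).
      { apply Rmult_le_compat_r; [apply pow2_ge_0|].
        apply Rmult_le_reg_l with (2 * e); [lra|].
        replace (2 * e * (c / e / 2)) with c by (field; lra). lra. }
      lra. }
  (* Source over damping rate, the level at which [g ^ 2] saturates, is [C2 * e ^ 2]. *)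
  assert (Hbe : b / (- (c / e)) = - (C2 * e ^ 2)).
  { unfold b, C2. rewrite Hlc. field. lra. }
  rewrite Hbe in HW.
  assert (Hx : 0 <= exp (- (c / e) * t) <= 1).
  { split; [apply Rlt_le, exp_pos|]. rewrite <- exp_0.
    assert (- (c / e) * t <= 0) as [E|E]; [nra|apply Rlt_le, exp_increasing, E|].
    rewrite E. lra. }
  assert (Hg0 := pow2_ge_0 (gam 0)).
  assert (Hge : gam 0 ^ 2 * exp (- (c / e) * t) <= gam 0 ^ 2 * 1)
    by (apply Rmult_le_compat_l; lra).
  assert (HC2e : 0 <= C2 * e ^ 2) by (apply Rmult_le_pos; [lra|apply pow2_ge_0]).
  assert (HC2e2 : C2 * e ^ 2 <= C2 * e) by (apply Rmult_le_compat_l; [lra|nra]).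
  assert (HC1e : 0 <= C1 * e) by (apply Rmult_le_pos; lra).
  assert (Hxe : 0 <= C2 * e ^ 2 * exp (- (c / e) * t)) by (apply Rmult_le_pos; lra).
  unfold gam in *. lra.
Qed.

End Singular_perturbation.

(** * Asymptotic preservation *)

Lemma norm_pair_le (a b : R) : norm (a, b) <= Rabs a + Rabs b.
Proof.
  change (norm (a, b)) with (sqrt (Rabs a ^ 2 + Rabs b ^ 2)).
  assert (Ha := Rabs_pos a). assert (Hb := Rabs_pos b).
  apply Rle_trans with (sqrt ((Rabs a + Rabs b) ^ 2)).
  - apply sqrt_le_1_alt. nra.
  - rewrite sqrt_pow2; lra.
Qed.

(** The Euclidean norm is at most the sum of the absolute values; [Rabs K] supplies the nonnegative
    constant that this comparison requires. *)
Lemma lipschitz_norm_abs (g : R -> R -> R) (K : R) :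
  (forall y1 z1 y2 z2, Rabs (g y1 z1 - g y2 z2) <= K * norm (y1 - y2, z1 - z2)) ->
  lipschitz2 (Rabs K) g.
Proof.
  intros H a b a' b'. apply Rle_trans with (1 := H a b a' b').
  apply Rle_trans with (Rabs K * norm (a - a', b - b')).
  - apply Rmult_le_compat_r; [apply norm_ge_0|apply Rle_abs].
  - apply Rmult_le_compat_l; [apply Rabs_pos|apply norm_pair_le].
Qed.

Lemma lipschitz2_weaken (K K' : R) (F : R -> R -> R) :
  K <= K' -> lipschitz2 K F -> lipschitz2 K' F.
Proof.
  intros HK H a b a' b'. apply Rle_trans with (1 := H a b a' b').
  apply Rmult_le_compat_r; [|exact HK].
  apply Rplus_le_le_0_compat; apply Rabs_pos.
Qed.

Lemma lipschitz2_scal (K r : R) (F : R -> R -> R) :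
  0 <= r -> lipschitz2 K F -> lipschitz2 (r * K) (fun y z => r * F y z).
Proof.
  intros Hr H a b a' b'.
  replace (r * F a b - r * F a' b') with (r * (F a b - F a' b')) by ring.
  rewrite Rabs_mult, (Rabs_pos_eq r Hr), Rmult_assoc.
  apply Rmult_le_compat_l; [exact Hr|apply H].
Qed.

Lemma step_size_lim (T : R) : is_lim_seq (fun N => T / INR N) 0.
Proof.
  apply lim_eq with (T * 0); [ring|]. unfold Rdiv.
  apply lim_mult; [exact _|apply filterlim_const|].
  apply (is_lim_seq_inv INR p_infty); [exact is_lim_seq_INR|discriminate].
Qed.

(** The error bound compares at the grid time [tau N]; continuity of [X] carries the limit over to
    [t]. *)
Lemma read_off_lim (X : R -> R) (u tau : nat -> R) (K T t : R) :
  continuity_pt X t -> is_lim_seq tau t ->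
  eventually (fun N => Rabs (u N - X (tau N)) <= K * (T / INR N)) ->
  is_lim_seq u (X t).
Proof.
  intros HX Htau Hu.
  assert (H1 : is_lim_seq (fun N => u N - X (tau N)) 0).
  { apply lim_squeeze with (fun N => K * (T / INR N)); [exact _| |].
    - revert Hu. apply filter_imp. intros N. rewrite Rminus_0_r. tauto.
    - apply lim_eq with (K * 0); [ring|].
      apply lim_mult; [exact _|apply filterlim_const|apply step_size_lim]. }
  assert (H2 : is_lim_seq (fun N => X (tau N)) (X t)).
  { apply continuity_pt_filterlim in HX.
    exact (filterlim_comp _ _ _ tau X _ _ _ Htau HX). }
  apply lim_eq with (0 + X t); [ring|].
  generalize (lim_plus eventually _ _ _ _ H1 H2). apply filterlim_ext.
  intros N. ring.
Qed.

Lemma square_lim {S : Type} (F : (S -> Prop) -> Prop) {FF : Filter F}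
    (f h : S -> R) (l : R) :
  F (fun x => (f x - l) ^ 2 <= h x) -> filterlim h F (locally 0) ->
  filterlim f F (locally l).
Proof.
  intros Hf Hh. apply lim_eps; [exact FF|]. intros eps He.
  generalize (proj1 (lim_eps _ _ _) Hh (eps ^ 2) (pow_lt _ _ He)). revert Hf.
  apply filter_imp2; [exact FF|]. intros x H1 H2. rewrite Rminus_0_r in H2.
  rewrite <- pow2_abs in H1. assert (H3 := Rle_abs (h x)).
  assert (H4 := Rabs_pos (f x - l)). apply Rnot_le_lt. intros H5. nra.
Qed.

Section Preservation.

Context (g : R -> R -> R) (c L Ld eps0 : R) (kmax : nat)
  (g_smooth : smooth g) (c_pos : 0 < c)
  (dz_neg : forall y z, dz g y z < - c)
  (g_lip : lipschitz2 L g)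
  (eps0_pos : 0 < eps0) (Ld_pos : 0 <= Ld)
  (gdot_lip : forall e, 0 < e < eps0 -> lipschitz2 (Ld / e) (gdot g e))
  (zeta : R -> R) (zeta_zero : forall y, g y (zeta y) = 0).

Let l := L / c.

(** * Local error of the limit scheme *)

Lemma l_pos : 0 <= l.
Proof. apply Rle_mult_inv_pos; [exact (lip_pos g L g_lip)|exact c_pos]. Qed.

Lemma zeta_lip (a b : R) : Rabs (zeta a - zeta b) <= l * Rabs (a - b).
Proof. exact (zeta_lipschitz g c L g_smooth c_pos dz_neg g_lip zeta zeta_zero a b). Qed.

Lemma zeta_growth :
  exists B, 0 <= B /\ forall a, Rabs (zeta a) <= B * (1 + Rabs a) /\
    Rabs (zeta_rate g zeta a) <= B * (1 + Rabs a).
Proof.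
  assert (Hl := l_pos). set (B := Rabs (zeta 0) + l).
  assert (HB : 0 <= B) by (unfold B; generalize (Rabs_pos (zeta 0)); lra).
  assert (HlB : 0 <= l * B) by (apply Rmult_le_pos; assumption).
  exists (B + l * B). split; [lra|]. intros a.
  assert (Ha := Rabs_pos a).
  assert (H1 : Rabs (zeta a) <= B * (1 + Rabs a)).
  { generalize (zeta_lip a 0). rewrite Rminus_0_r. intros H.
    replace (zeta a) with (zeta 0 + (zeta a - zeta 0)) by ring.
    apply Rle_trans with (1 := Rabs_triang _ _).
    assert (0 <= Rabs (zeta 0) * Rabs a) by (apply Rmult_le_pos; [apply Rabs_pos|lra]).
    unfold B. lra. }
  assert (H2 : Rabs (zeta_rate g zeta a) <= l * Rabs (zeta a)).
  { unfold zeta_rate. set (z := zeta a).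
    assert (Hz := dz_neg a z). assert (Hy := dy_bounded g L g_smooth g_lip a z).
    replace (l * Rabs z) with (L * Rabs z / c) by (unfold l; field; lra).
    unfold Rdiv. rewrite Rabs_mult, Rabs_Ropp, Rabs_mult, Rabs_inv, (Rabs_left (dz g a z)) by lra.
    apply Rmult_le_compat.
    - apply Rmult_le_pos; apply Rabs_pos.
    - apply Rlt_le, Rinv_0_lt_compat. lra.
    - apply Rmult_le_compat_r; [apply Rabs_pos|exact Hy].
    - apply Rinv_le_contravar; lra. }
  apply (Rmult_le_compat_l l _ _ Hl) in H1 as H3.
  assert (0 <= l * B * (1 + Rabs a)) by (apply Rmult_le_pos; lra).
  assert (0 <= B * (1 + Rabs a)) by (apply Rmult_le_pos; lra).
  split; lra.
Qed.

(** Lipschitz continuity is used for [zeta] and only linear growth for [zeta_rate], whose Lipschitz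
    constant would involve second derivatives of g. Growth is enough because [zeta_rate] already
    carries a factor [dt ^ 2]. *)
Lemma limit_stage_error (k : nat) :
  exists C, 0 <= C /\ forall dt a, 0 < dt -> dt <= 1 ->
    Rabs (limit_stage g zeta dt a k - a - dt * zeta a) <= C * dt ^ 2 * (1 + Rabs a).
Proof.
  assert (Hl := l_pos). destruct zeta_growth as [B [HB Hgrowth]].
  induction k as [|k [C [HC IH]]].
  - exists B. split; [exact HB|]. intros dt a Hdt Hdt1. cbn [limit_stage].
    destruct (square_small dt Hdt Hdt1) as [Hsq _].
    replace (a + dt * zeta a + dt ^ 2 / 2 * zeta_rate g zeta a - a - dt * zeta a) with
      (dt ^ 2 / 2 * zeta_rate g zeta a) by ring.
    rewrite Rabs_mult, (Rabs_pos_eq (dt ^ 2 / 2)) by lra.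
    replace (B * dt ^ 2 * (1 + Rabs a)) with (dt ^ 2 * (B * (1 + Rabs a))) by ring.
    apply Rmult_le_compat; [lra|apply Rabs_pos|lra|apply Hgrowth].
  - set (M := B + C). assert (HM : 0 <= M) by (unfold M; lra).
    assert (HlM : 0 <= l * M) by (apply Rmult_le_pos; assumption).
    assert (HBM : 0 <= B * M) by (apply Rmult_le_pos; assumption).
    exists (l * M + 2 * B + B * M). split; [lra|]. intros dt a Hdt Hdt1.
    cbn [limit_stage]. specialize (IH dt a Hdt Hdt1).
    set (b := limit_stage g zeta dt a k) in *.
    destruct (square_small dt Hdt Hdt1) as [Hsq Hsq1].
    set (W := 1 + Rabs a) in *.
    assert (HW : 1 <= W) by (unfold W; generalize (Rabs_pos a); lra).
    destruct (Hgrowth a) as [Z1 Z2]. destruct (Hgrowth b) as [_ Z3]. fold W in Z1, Z2.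
    assert (Hab : Rabs (b - a) <= M * (dt * W)).
    { replace (b - a) with (dt * zeta a + (b - a - dt * zeta a)) by ring.
      apply Rle_trans with (1 := Rabs_triang _ _).
      rewrite Rabs_mult, (Rabs_pos_eq dt) by lra.
      assert (dt * Rabs (zeta a) <= dt * (B * W)) by (apply Rmult_le_compat_l; lra).
      assert (C * dt ^ 2 * W <= C * dt * W).
      { apply Rmult_le_compat_r; [lra|]. apply Rmult_le_compat_l; lra. }
      unfold M. lra. }
    assert (HMW : M * (dt * W) <= M * W).
    { apply Rmult_le_compat_l; [exact HM|].
      rewrite <- (Rmult_1_l W) at 2. apply Rmult_le_compat_r; lra. }
    assert (Hb : 1 + Rabs b <= W + M * W).
    { replace b with (a + (b - a)) by ring.
      generalize (Rabs_triang a (b - a)). unfold W in *. lra. }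
    apply (Rmult_le_compat_l B _ _ HB) in Hb.
    assert (T1 : Rabs (dt / 2 * (zeta b - zeta a)) <= l * M * (dt ^ 2 * W)).
    { rewrite Rabs_mult, (Rabs_pos_eq (dt / 2)) by lra.
      replace (l * M * (dt ^ 2 * W)) with (dt * (l * (M * (dt * W)))) by ring.
      apply Rmult_le_compat; [lra|apply Rabs_pos|lra|].
      apply Rle_trans with (1 := zeta_lip b a).
      apply Rmult_le_compat_l; assumption. }
    assert (T2 : Rabs (dt ^ 2 / 12 * (zeta_rate g zeta a - zeta_rate g zeta b))
      <= dt ^ 2 * (B * W + B * (W + M * W))).
    { rewrite Rabs_mult, (Rabs_pos_eq (dt ^ 2 / 12)) by lra.
      apply Rmult_le_compat; [lra|apply Rabs_pos|lra|].
      apply Rle_trans with (1 := Rabs_triang _ _). rewrite Rabs_Ropp. lra. }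
    replace (a + dt / 2 * (zeta a + zeta b)
      + dt ^ 2 / 12 * (zeta_rate g zeta a - zeta_rate g zeta b) - a - dt * zeta a) with
      (dt / 2 * (zeta b - zeta a)
      + dt ^ 2 / 12 * (zeta_rate g zeta a - zeta_rate g zeta b)) by field.
    apply Rle_trans with (1 := Rabs_triang _ _). lra.
Qed.

(** * The limit problem and consistency *)

Lemma limit_solution_z (T : R) (Y Z : R -> R) (s : R) :
  limit_solution g T Y Z -> 0 <= s <= T -> Z s = zeta (Y s).
Proof.
  intros [_ [_ H0]] Hs.
  exact (zeta_unique g c g_smooth c_pos dz_neg zeta zeta_zero _ _ (H0 s Hs)).
Qed.

(* The limit problem Y' = zeta (Y) is treated as a planar system with a
   vanishing second component; [X] extends [Y] continuously beyond [0, T]. *)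
Lemma limit_solution_solves (T : R) (Y Z : R -> R) :
  limit_solution g T Y Z ->
  exists X, (forall s, 0 <= s <= T -> X s = Y s) /\
    solves (fun a _ => zeta a) (fun _ _ => 0) T X (fun _ => 0).
Proof.
  intros Hsol. assert (HZ := fun s => limit_solution_z T Y Z s Hsol).
  destruct Hsol as [Hc [Hd H0]].
  exists (fun s => Y (Rmax 0 (Rmin T s))).
  assert (Hclip : forall s, 0 <= s <= T -> Rmax 0 (Rmin T s) = s).
  { intros s Hs. rewrite Rmin_right, Rmax_right; lra. }
  split; [intros s Hs; rewrite Hclip; [reflexivity|exact Hs]|].
  split; [|split; [|split]].
  - intros s Hs. apply continuity_pt_filterlim. rewrite (Hclip s Hs).
    intros P HP. destruct (Hc s Hs P HP) as [d Hd'].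
    exists d. intros r Hr. apply Hd'.
    + change (Rabs (r - s) < d) in Hr. change (Rabs (Rmax 0 (Rmin T r) - s) < d).
      apply Rle_lt_trans with (2 := Hr).
      unfold Rmax, Rmin. repeat destruct Rle_dec; unfold Rabs;
        repeat destruct Rcase_abs; lra.
    + unfold Rmax, Rmin. repeat destruct Rle_dec; lra.
  - intros s _. apply continuity_pt_const. intros a b. reflexivity.
  - intros s Hs. rewrite Hclip by lra. rewrite <- HZ by lra.
    apply is_derive_ext_loc with Y; [|apply Hd, Hs].
    assert (Hm : 0 < Rmin s (T - s)) by (apply Rmin_pos; lra).
    exists (mkposreal _ Hm). intros r Hr. change (Rabs (r - s) < Rmin s (T - s)) in Hr.
    rewrite Hclip; [reflexivity|].
    generalize (Rmin_l s (T - s)) (Rmin_r s (T - s)) (Rabs_def2 _ _ Hr). lra.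
  - intros s _. apply (is_derive_const (V := R_NormedModule) 0).
Qed.

Lemma zeta_lipschitz2 : lipschitz2 l (fun a _ => zeta a).
Proof.
  intros a b a' b'. apply Rle_trans with (1 := zeta_lip a a').
  apply Rmult_le_compat_l; [exact l_pos|]. generalize (Rabs_pos (b - b')). lra.
Qed.

Lemma zero_lipschitz2 (K : R) : 0 <= K -> lipschitz2 K (fun _ _ => 0).
Proof.
  intros HK a b a' b'. rewrite Rminus_0_r, Rabs_R0.
  apply Rmult_le_pos; [exact HK|]. apply Rplus_le_le_0_compat; apply Rabs_pos.
Qed.

(** [limit_step] allows any family of well-prepared data with the given leading coefficients; the
    limit does not depend on the family, so the relation is a function of [(dt, y)]. *)
Lemma limit_step_unique (dt y z y' z' : R) :
  0 < dt -> limit_step g kmax dt y z y' z' ->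
  y' = limit_stage g zeta dt y kmax /\ z' = zeta y'.
Proof.
  intros Hdt (ye & ze & ye' & ze' & yc & zc & [_ [_ Hw]] & Hy & Hz & <- & <- & Hs & Ly & Lz).
  destruct (Hw yc zc Hy Hz) as [W1 W2].
  assert (S0 := prepared_settles g zeta c g_smooth c_pos dz_neg zeta_zero
    _ _ _ _ Hy Hz W1 W2).
  destruct (settles_step g zeta c L g_smooth c_pos dz_neg g_lip zeta_zero
    kmax dt _ _ _ _ _ Hdt S0 Hs) as [H1 [H2 _]].
  assert (E := filterlim_locally_unique (V := R_NormedModule) _ _ _ Ly H1).
  split; [exact E|]. rewrite E.
  exact (filterlim_locally_unique (V := R_NormedModule) _ _ _ Lz H2).
Qed.

Lemma method_consistent : limit_consistent g kmax.
Proof.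
  intros T Y Z HT Hsol eta Heta.
  assert (HZ := fun s => limit_solution_z T Y Z s Hsol).
  destruct (limit_solution_solves T Y Z Hsol) as [X [HX Hsolves]].
  destruct (solution_bounded _ _ T X _ HT Hsolves) as [M [HM Hb]].
  destruct (solution_euler _ _ l T X _ l_pos HT zeta_lipschitz2
    (zero_lipschitz2 l l_pos) Hsolves) as [C0 [HC0 Heuler]].
  destruct (limit_stage_error kmax) as [C [HC Hstage]].
  assert (Hl := l_pos).
  (* The stage error along the bounded curve [Y] plus the Euler remainder of [Y] itself. *)
  set (Q := C * (1 + M) + C0).
  assert (HQ : 0 <= Q).
  { unfold Q. assert (0 <= C * (1 + M)) by (apply Rmult_le_pos; lra). lra. }
  assert (HlQ : 0 <= l * Q) by (apply Rmult_le_pos; assumption).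
  (* The error is [Q * dt ^ 2] in y and, through [zeta], [l * Q * dt ^ 2] in z; this threshold makes
     [(Q + l * Q) * dt <= eta]. *)
  exists (Rmin 1 (eta / (Q + l * Q + 1))). split.
  { apply Rmin_pos; [lra|]. apply Rdiv_lt_0_compat; lra. }
  intros s dt y' z' Hs [Hdt Hdtd] Hsdt Hstep.
  assert (Hd1 := Rmin_l 1 (eta / (Q + l * Q + 1))).
  assert (Hd2 := Rmin_r 1 (eta / (Q + l * Q + 1))).
  destruct (limit_step_unique _ _ _ _ _ Hdt Hstep) as [Ey Ez].
  rewrite (HZ (s + dt)) by lra. rewrite Ez.
  assert (Hsize : (Q + l * Q) * dt <= eta).
  { assert (X1 : dt * (Q + l * Q + 1) <= eta / (Q + l * Q + 1) * (Q + l * Q + 1))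
      by (apply Rmult_le_compat_r; lra).
    replace (eta / (Q + l * Q + 1) * (Q + l * Q + 1)) with eta in X1 by (field; lra).
    lra. }
  assert (Hy : Rabs (y' - Y (s + dt)) <= Q * dt ^ 2).
  { destruct (Heuler s dt Hs (Rlt_le _ _ Hdt) Hsdt) as [E1 _].
    rewrite !HX in E1 by lra. specialize (Hb s ltac:(lra)). rewrite HX in Hb by lra.
    rewrite Rabs_R0, Rplus_0_r in Hb.
    assert (E2 := Hstage dt (Y s) Hdt ltac:(lra)). rewrite <- Ey in E2.
    replace (y' - Y (s + dt)) with ((y' - Y s - dt * zeta (Y s))
      + - (Y (s + dt) - Y s - dt * zeta (Y s))) by ring.
    apply Rle_trans with (1 := Rabs_triang _ _). rewrite Rabs_Ropp.
    assert (C * dt ^ 2 * (1 + Rabs (Y s)) <= C * dt ^ 2 * (1 + M)).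
    { apply Rmult_le_compat_l; [apply Rmult_le_pos; [lra|apply pow2_ge_0]|lra]. }
    unfold Q. lra. }
  assert (Hz := zeta_lip y' (Y (s + dt))).
  apply (Rmult_le_compat_l l _ _ Hl) in Hy as Hly.
  assert (Hfin : (Q + l * Q) * dt * dt <= eta * dt) by (apply Rmult_le_compat_r; lra).
  assert (P1 : 0 <= Q * dt ^ 2) by (apply Rmult_le_pos; [lra|apply pow2_ge_0]).
  assert (P2 : 0 <= l * Q * dt ^ 2) by (apply Rmult_le_pos; [lra|apply pow2_ge_0]).
  split; lra.
Qed.

Lemma limit_scheme_converges (T : R) (Y Z : R -> R) (t : R) (nu : nat -> nat) :
  0 < T -> limit_solution g T Y Z -> 0 <= t <= T ->
  (forall N, (nu N <= N)%nat) ->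
  is_lim_seq (fun N => INR (nu N) * (T / INR N)) t ->
  is_lim_seq (fun N => limit_iterate g zeta kmax (T / INR N) (Y 0) (nu N)) (Y t).
Proof.
  intros HT Hsol Ht Hnu Hlim.
  destruct (limit_solution_solves T Y Z Hsol) as [X [HX Hsolves]].
  destruct (limit_stage_error kmax) as [A [HA Hstage]].
  destruct (first_order_convergence _ _ l T X _ l_pos HT zeta_lipschitz2
    (zero_lipschitz2 l l_pos) Hsolves A HA) as [K [HK Hconv]].
  rewrite <- (HX t Ht).
  apply read_off_lim with (fun N => INR (nu N) * (T / INR N)) K T;
    [apply Hsolves; exact Ht|exact Hlim|].
  assert (Hpos : eventually (fun N => (0 < N)%nat)) by (exists 1%nat; intros; lia).
  generalize (proj1 (lim_eps _ _ _) (step_size_lim T) 1 Rlt_0_1).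
  revert Hpos. apply filter_imp2; [exact _|]. intros N HN Hdt1.
  rewrite Rminus_0_r in Hdt1. assert (HN' := lt_0_INR N HN).
  assert (Hdt : 0 < T / INR N) by (apply Rdiv_lt_0_compat; assumption).
  rewrite Rabs_pos_eq in Hdt1 by lra.
  assert (H : forall n, (n <= N)%nat ->
    Rabs (limit_iterate g zeta kmax (T / INR N) (Y 0) n - X (INR n * (T / INR N)))
      + Rabs (0 - 0) <= K * (T / INR N)).
  { apply (Hconv _ N (limit_iterate g zeta kmax (T / INR N) (Y 0)) (fun _ => 0));
      [exact Hdt|right; field; lra|symmetry; apply HX; lra|reflexivity|].
    intros n _. rewrite Rmult_0_r, !Rminus_0_r, Rabs_R0, !Rplus_0_r.
    apply Hstage; lra. }
  specialize (H (nu N) (Hnu N)).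
  rewrite Rminus_0_r, Rabs_R0, Rplus_0_r in H. exact H.
Qed.

(** * The limit dt -> 0 with fixed e, and the exact solution as e -> 0 *)

Lemma force_bounds (e : R) :
  0 < e < eps0 ->
  exists A, 0 < A /\ lipschitz2 A (fun _ z => z) /\
    lipschitz2 A (force g e) /\ lipschitz2 A (force_rate g e) /\
    (forall y z, Rabs (force g e y z) <= A * (1 + Rabs y + Rabs z)) /\
    (forall y z, Rabs (force_rate g e y z) <= A * (1 + Rabs y + Rabs z)).
Proof.
  intros He. assert (HL := lip_pos g L g_lip).
  assert (Hie : 0 <= 1 / e) by (apply Rlt_le, Rdiv_lt_0_compat; lra).
  assert (P1 : 0 <= 1 / e * L) by (apply Rmult_le_pos; assumption).
  assert (P2 : 0 <= 1 / e * (Ld / e)).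
  { apply Rmult_le_pos; [exact Hie|]. apply Rle_mult_inv_pos; lra. }
  assert (P3 := Rabs_pos (force g e 0 0)). assert (P4 := Rabs_pos (force_rate g e 0 0)).
  (* [A] depends on e and may blow up as e -> 0, which is harmless while e is fixed. The values at
     the origin enter for the growth bounds. *)
  set (A := 1 + 1 / e * L + 1 / e * (Ld / e)
    + Rabs (force g e 0 0) + Rabs (force_rate g e 0 0)).
  assert (Hf : lipschitz2 A (force g e)).
  { apply lipschitz2_weaken with (1 / e * L); [unfold A; lra|].
    apply lipschitz2_scal; assumption. }
  assert (Hh : lipschitz2 A (force_rate g e)).
  { apply lipschitz2_weaken with (1 / e * (Ld / e)); [unfold A; lra|].
    apply lipschitz2_scal; [exact Hie|apply gdot_lip, He]. }
  assert (HA : 0 < A) by (unfold A; lra).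
  exists A. split; [exact HA|]. split; [|split; [exact Hf|split; [exact Hh|split]]].
  - intros a b a' b'. assert (Q1 := Rabs_pos (a - a')). assert (Q2 := Rabs_pos (b - b')).
    assert (1 * (Rabs (a - a') + Rabs (b - b')) <= A * (Rabs (a - a') + Rabs (b - b')));
      [|lra].
    apply Rmult_le_compat_r; [lra|unfold A; lra].
  - intros y z. apply Rle_trans with (1 := lipschitz2_growth _ _ y z Hf).
    unfold A in *. lra.
  - intros y z. apply Rle_trans with (1 := lipschitz2_growth _ _ y z Hh).
    unfold A in *. lra.
Qed.

Lemma method_converges (e T : R) (y z : R -> R) (u v : nat -> nat -> R)
    (t : R) (nu : nat -> nat) :
  0 < e < eps0 -> 0 < T -> solves (fun _ z => z) (force g e) T y z ->
  (forall N, u N 0%nat = y 0 /\ v N 0%nat = z 0) ->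
  eventually (fun N => numerical_solution g kmax e (T / INR N) N (u N) (v N)) ->
  0 <= t <= T -> (forall N, (nu N <= N)%nat) ->
  is_lim_seq (fun N => INR (nu N) * (T / INR N)) t ->
  is_lim_seq (fun N => u N (nu N)) (y t) /\ is_lim_seq (fun N => v N (nu N)) (z t).
Proof.
  intros He HT Hsol H0 Hnum Ht Hnu Hlim.
  destruct (force_bounds e He) as [A [HA [Hid [Hf [Hh [Bf Bh]]]]]].
  destruct (one_step_error g e A (proj1 He) HA Hf Hh Bf Bh kmax) as [Q [HQ Hstep]].
  destruct (first_order_convergence _ _ A T y z (Rlt_le _ _ HA) HT Hid Hf Hsol Q HQ)
    as [K [HK Hconv]].
  assert (Hpos : eventually (fun N => (0 < N)%nat)) by (exists 1%nat; intros; lia).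
  (* The thresholds [dt <= 1] and [4 * A * dt <= 1] of [one_step_error]. *)
  assert (Hsmall : 0 < Rmin 1 (/ (4 * A))).
  { apply Rmin_pos; [lra|]. apply Rinv_0_lt_compat. lra. }
  assert (Herr : eventually (fun N =>
    Rabs (u N (nu N) - y (INR (nu N) * (T / INR N))) +
    Rabs (v N (nu N) - z (INR (nu N) * (T / INR N))) <= K * (T / INR N))).
  { generalize (filter_and _ _ Hpos Hnum).
    generalize (proj1 (lim_eps _ _ _) (step_size_lim T) _ Hsmall).
    apply filter_imp2; [exact _|]. intros N Hdt1 [HN Hn].
    rewrite Rminus_0_r in Hdt1. assert (HN' := lt_0_INR N HN).
    assert (Hdt : 0 < T / INR N) by (apply Rdiv_lt_0_compat; assumption).
    rewrite Rabs_pos_eq in Hdt1 by lra.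
    assert (M1 := Rmin_l 1 (/ (4 * A))). assert (M2 := Rmin_r 1 (/ (4 * A))).
    apply (Hconv (T / INR N) N (u N) (v N)); [exact Hdt| | | | |apply Hnu].
    - right. field. lra.
    - apply H0.
    - apply H0.
    - intros n Hn'. apply Hstep; [exact Hdt|lra| |apply Hn, Hn'].
      apply Rmult_le_reg_l with (/ (4 * A)); [apply Rinv_0_lt_compat; lra|].
      rewrite <- Rmult_assoc, Rinv_l by lra. lra. }
  split.
  - apply read_off_lim with (fun N => INR (nu N) * (T / INR N)) K T;
      [apply Hsol; exact Ht|exact Hlim|].
    revert Herr. apply filter_imp. intros N.
    generalize (Rabs_pos (v N (nu N) - z (INR (nu N) * (T / INR N)))). lra.
  - apply read_off_lim with (fun N => INR (nu N) * (T / INR N)) K T;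
      [apply Hsol; exact Ht|exact Hlim|].
    revert Herr. apply filter_imp. intros N.
    generalize (Rabs_pos (u N (nu N) - y (INR (nu N) * (T / INR N)))). lra.
Qed.

Lemma exact_solution_limit (T : R) (Y Z : R -> R) (ye ze : R -> R -> R) (t : R) :
  0 < T -> limit_solution g T Y Z -> 0 <= t <= T ->
  (forall e, 0 < e -> solves (fun _ z => z) (force g e) T (ye e) (ze e)) ->
  filterlim (fun e => ye e 0) (at_right 0) (locally (Y 0)) ->
  filterlim (fun e => ze e 0) (at_right 0) (locally (Z 0)) ->
  filterlim (fun e => ye e t) (at_right 0) (locally (Y t)) /\
  filterlim (fun e => ze e t) (at_right 0) (locally (Z t)).
Proof.
  intros HT Hsol Ht Hex Hy0 Hz0.
  assert (HZ := fun s => limit_solution_z T Y Z s Hsol).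
  rewrite (HZ 0) in Hz0 by lra. rewrite (HZ t Ht).
  destruct (limit_solution_solves T Y Z Hsol) as [X [HX [Xc [_ [Xd _]]]]].
  destruct (singular_perturbation g c L g_smooth c_pos dz_neg g_lip zeta zeta_zero
    T X HT Xc Xd) as [e1 [K [He1 [HK Hpert]]]].
  (* The initial Lyapunov value tends to 0 because the initial data converge to a point of the limit
     solution. *)
  set (V0 := fun e => (ye e 0 - X 0) ^ 2 + e / c * g (ye e 0) (ze e 0) ^ 2).
  assert (Hg0 : filterlim (fun e => g (ye e 0) (ze e 0)) (at_right 0) (locally 0)).
  { generalize (lim_2d _ g _ _ _ _ (smooth_continuous g _ _ g_smooth) Hy0 Hz0).
    rewrite zeta_zero. tauto. }
  assert (Hid := at_right_id).
  assert (Hb : filterlim (fun e => K * (V0 e + e)) (at_right 0) (locally 0)).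
  { apply lim_eq with
      (K * ((Y 0 - Y 0) * ((Y 0 - Y 0) * 1) + 0 * / c * (0 * (0 * 1)) + 0)); [ring|].
    unfold V0. rewrite HX by lra. simpl pow. unfold Rdiv. limits. }
  assert (Hrange : at_right 0 (fun e => 0 < e < e1)).
  { generalize at_right_pos (at_right_lt e1 He1). apply filter_imp2; [exact _|].
    intros e P1 P2. split; assumption. }
  assert (Hy : filterlim (fun e => ye e t) (at_right 0) (locally (Y t))).
  { apply square_lim with (fun e => K * (V0 e + e)); [exact _| |exact Hb].
    revert Hrange. apply filter_imp. intros e He.
    rewrite <- (HX t Ht). apply (Hpert e (ye e) (ze e) He (Hex e (proj1 He)) t Ht). }
  split; [exact Hy|].
  assert (Hgt : filterlim (fun e => g (ye e t) (ze e t)) (at_right 0) (locally 0)).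
  { apply square_lim with (fun e => g (ye e 0) (ze e 0) ^ 2 + K * e); [exact _| |].
    - generalize (proj1 (lim_eps _ _ _) Hb 1 Rlt_0_1). revert Hrange.
      apply filter_imp2; [exact _|]. intros e He H1. rewrite Rminus_0_r in *.
      apply (Hpert e (ye e) (ze e) He (Hex e (proj1 He)) t Ht).
      apply Rle_trans with (1 := Rle_abs _). apply Rlt_le, H1.
    - apply lim_eq with (0 * (0 * 1) + K * 0); [ring|]. simpl pow. limits. }
  apply lim_squeeze with (fun e => Rabs (g (ye e t) (ze e t)) * / c
    + l * Rabs (ye e t - Y t)); [exact _| |].
  - apply filter_forall. intros e.
    replace (ze e t - zeta (Y t)) with
      ((ze e t - zeta (ye e t)) + (zeta (ye e t) - zeta (Y t))) by ring.
    apply Rle_trans with (1 := Rabs_triang _ _). apply Rplus_le_compat.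
    + exact (zeta_distance g c g_smooth c_pos dz_neg zeta zeta_zero _ _).
    + apply zeta_lip.
  - apply (proj1 (lim_abs_0 _ _)) in Hgt.
    assert (Hd : filterlim (fun e => Rabs (ye e t - Y t)) (at_right 0) (locally 0)).
    { apply (proj1 (lim_abs_0 _ _)). apply lim_eq with (Y t - Y t); [ring|].
      limits. }
    apply lim_eq with (0 * / c + l * 0); [ring|]. limits.
Qed.

Lemma method_limits_commute : limits_commute g kmax.
Proof.
  intros T y0 z0 yc zc y z Y Z HT [_ [_ Hw]] Hy0 Hz0 Hinit Hnum Hnum' _ Hsol EY EZ
    t nu Ht Hnu Hlim.
  destruct (Hw yc zc Hy0 Hz0) as [W1 W2].
  assert (S0 := prepared_settles g zeta c g_smooth c_pos dz_neg zeta_zero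
    _ _ _ _ Hy0 Hz0 W1 W2).
  assert (HZ := limit_solution_z T Y Z t Hsol Ht).
  split.
  - assert (HV := limit_scheme_converges T Y Z t nu HT Hsol Ht Hnu Hlim).
    rewrite EY in HV.
    set (V := fun N => limit_iterate g zeta kmax (T / INR N) (yc 0%nat) (nu N)) in *.
    exists (fun N => (V N, zeta (V N))). split.
    (* Only [N >= 1] gives a positive step size. *)
    + exists 1%nat. intros N HN.
      assert (Hdt : 0 < T / INR N) by (apply Rdiv_lt_0_compat; [exact HT|apply lt_0_INR; lia]).
      assert (S1 : settles g zeta (fun e => y N e 0%nat) (fun e => z N e 0%nat) (yc 0%nat)).
      { destruct S0 as [A1 [A2 A3]].
        split; [|split]; [revert A1|revert A2|revert A3]; apply filterlim_ext;
          intros e; destruct (Hinit N e) as [E1 E2]; rewrite ?E1, ?E2; reflexivity. }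
      destruct (settles_iterate g zeta c L g_smooth c_pos dz_neg g_lip zeta_zero
        kmax _ N (y N) (z N) _ Hdt (Hnum N ltac:(lia)) S1 (nu N) (Hnu N))
        as [H1 [H2 _]].
      apply lim_pair; [exact _|exact H1|exact H2].
    + apply lim_pair; [exact _|exact HV|]. rewrite HZ.
      assert (Hzc := zeta_continuous g c L g_smooth c_pos dz_neg g_lip zeta zeta_zero (Y t)).
      apply continuity_pt_filterlim in Hzc.
      exact (filterlim_comp _ _ _ V zeta _ _ _ HV Hzc).
  (* The inner limit is the exact solution for parameter e. Choice needs a value for every real e,
     hence the zero functions when e is not positive. *)
  - assert (Hex : forall e, exists p : (R -> R) * (R -> R), 0 < e ->
      fst p 0 = y0 e /\ snd p 0 = z0 e /\
      forall T, solves (fun _ z => z) (force g e) T (fst p) (snd p)).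
    { intros e. destruct (Rlt_dec 0 e) as [He|He].
      - assert (Hie : 0 < 1 / e) by (apply Rdiv_lt_0_compat; lra).
        assert (HL := lip_pos g L g_lip).
        assert (HeL : 0 <= 1 / e * L) by (apply Rmult_le_pos; lra).
        destruct (picard (fun _ z => z) (force g e) (1 + 1 / e * L) (y0 e) (z0 e))
          as [u [v [E1 [E2 H]]]].
        + lra.
        + intros a b a' b'. assert (Q1 := Rabs_pos (a - a')).
          assert (Q2 := Rabs_pos (b - b')).
          assert (0 <= 1 / e * L * (Rabs (a - a') + Rabs (b - b')))
            by (apply Rmult_le_pos; lra). lra.
        + apply lipschitz2_weaken with (1 / e * L); [lra|].
          apply lipschitz2_scal; [lra|exact g_lip].
        + exists (u, v). intros _. split; [exact E1|]. split; [exact E2|exact H].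
      - exists (fun _ => 0, fun _ => 0). intros He'. contradiction. }
    destruct (functional_choice _ Hex) as [p Hp].
    exists (fun e => (fst (p e) t, snd (p e) t)). split.
    + generalize at_right_pos (at_right_lt eps0 eps0_pos). revert Hnum'.
      intros H1 H2 H3. generalize (filter_and _ _ H1 (filter_and _ _ H2 H3)).
      apply filter_imp. intros e [Hn [He He0]]. destruct (Hp e He) as [E1 [E2 Hs]].
      destruct (method_converges e T (fst (p e)) (snd (p e)) (fun N => y N e)
        (fun N => z N e) t nu (conj He He0) HT (Hs T)) as [H4 H5]; try assumption.
      * intros N. rewrite E1, E2. apply Hinit.
      * apply lim_pair; [exact _|exact H4|exact H5].
    + destruct (exact_solution_limit T Y Z (fun e => fst (p e)) (fun e => snd (p e)) t
        HT Hsol Ht) as [H4 H5].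
      * intros e He. apply (Hp e He).
      * rewrite EY. generalize (hilbert_order0 _ _ Hy0). apply filterlim_ext_loc.
        generalize at_right_pos. apply filter_imp. intros e He.
        destruct (Hp e He) as [E1 _]. symmetry. exact E1.
      * rewrite EZ. generalize (hilbert_order0 _ _ Hz0). apply filterlim_ext_loc.
        generalize at_right_pos. apply filter_imp. intros e He.
        destruct (Hp e He) as [_ [E1 _]]. symmetry. exact E1.
      * apply lim_pair; [exact _|exact H4|exact H5].
Qed.

End Preservation.

Theorem theorem2 (g : R -> R -> R) (c Lg Lgdot eps0 : R) (kmax : nat)
  (g_smooth : smooth g)
  (c_pos : 0 < c)
  (dz_neg : forall y z : R, dz g y z < - c)
  (g_lipschitz : forall y1 z1 y2 z2 : R,
     Rabs (g y1 z1 - g y2 z2) <= Lg * norm (y1 - y2, z1 - z2))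
  (eps0_pos : 0 < eps0)
  (gdot_lipschitz : forall e : R, 0 < e < eps0 -> forall y1 z1 y2 z2 : R,
     Rabs (gdot g e y1 z1 - gdot g e y2 z2)
       <= Lgdot / e * norm (y1 - y2, z1 - z2)) :
  (forall (dt : R) (N : nat) (y z : R -> nat -> R),
     0 < dt ->
     at_right 0 (fun e => numerical_solution g kmax e dt N (y e) (z e)) ->
     well_prepared g (fun e => y e 0%nat) (fun e => z e 0%nat) ->
     (forall n : nat, (n <= N)%nat ->
        has_hilbert_expansion (fun e => y e n) /\
        has_hilbert_expansion (fun e => z e n)) ->
     forall n : nat, (n <= N)%nat ->
     forall yc zc : nat -> R,
       hilbert_expansion (fun e => y e n) yc ->
       hilbert_expansion (fun e => z e n) zc ->
       g (yc 0%nat) (zc 0%nat) = 0 /\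
       grad_dot g (yc 0%nat) (zc 0%nat) (zc 0%nat)
         (grad_dot g (yc 0%nat) (zc 0%nat) (yc 1%nat) (zc 1%nat)) = 0) /\
  asymptotic_preserving g kmax.
Proof.
  assert (g_lip := lipschitz_norm_abs g Lg g_lipschitz).
  assert (gdot_lip : forall e, 0 < e < eps0 -> lipschitz2 (Rabs Lgdot / e) (gdot g e)).
  { intros e He. assert (H := lipschitz_norm_abs _ _ (gdot_lipschitz e He)).
    unfold Rdiv in H. rewrite Rabs_mult, Rabs_inv, (Rabs_pos_eq e) in H by lra.
    exact H. }
  (* Choosing a zero for each y gives [zeta]; monotonicity in z makes the choice unique. *)
  destruct (functional_choice _ (g_has_zero g c g_smooth c_pos dz_neg))
    as [zeta zeta_zero].
  split; [|split].
  - intros dt N y z Hdt Hnum [[yc0 [Hy0 _]] [[zc0 [Hz0 _]] Hw]] _ n Hn yc zc Hy Hz.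
    destruct (Hw yc0 zc0 Hy0 Hz0) as [W1 W2].
    assert (S0 := prepared_settles g zeta c g_smooth c_pos dz_neg zeta_zero
      _ _ _ _ Hy0 Hz0 W1 W2).
    assert (Sn := settles_iterate g zeta c (Rabs Lg) g_smooth c_pos dz_neg g_lip
      zeta_zero kmax dt N y z _ Hdt Hnum S0 n Hn).
    exact (settles_prepared g zeta c g_smooth c_pos dz_neg zeta_zero
      _ _ _ _ _ Sn Hy Hz).
  - exact (method_consistent g c (Rabs Lg) kmax g_smooth c_pos dz_neg g_lip
      zeta zeta_zero).
  - exact (method_limits_commute g c (Rabs Lg) (Rabs Lgdot) eps0 kmax g_smooth c_pos
      dz_neg g_lip eps0_pos (Rabs_pos Lgdot) gdot_lip zeta zeta_zero).
Qed.
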